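(* Let $n$ be a positive integer, let $u$ be real with $-\infty<u<1$, and let $(x,y,z)$ be a point of the unit ball $x^2+y^2+z^2\le1$ with $r=\sqrt{x^2+y^2+z^2}$. The relative entropy of $\overset{n}{\otimes}\rho$ with respect to $\zeta_n(u)$ equals $$\frac n2(1-r)\log\frac{1-r}2+\frac n2(1+r)\log\frac{1+r}2-\sum_{d=0}^{\lfloor n/2\rfloor}\frac{n-2d+1}{n+1}\binom{n+1}{d}\frac{1}{2^{n+1}r}\Big((1+r)^{n-d+1}(1-r)^d-(1+r)^d(1-r)^{n-d+1}\Big)\log\lambda_d,$$ where $$\lambda_d=\frac{1}{2^n}\frac{\Gamma\left(\frac52-u\right)\,\Gamma(2+n-d-u)\,\Gamma(1+d-u)}{\Gamma\left(\frac52+\frac n2-u\right)\,\Gamma\left(2+\frac n2-u\right)\,\Gamma(1-u)} .$$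
   Context: For $(x,y,z)$ in the unit ball, $$\rho=\frac12\begin{pmatrix}1+z & x-iy \\ x+iy & 1-z\end{pmatrix},$$ and $\overset{n}{\otimes}\rho$ is its $n$-fold tensor power, a $2^n\times2^n$ density matrix. The matrix $\zeta_n(u)$ is the average $$\zeta_n(u)=\int_{x^2+y^2+z^2\le1}\Big(\overset{n}{\otimes}\rho\Big)\,q(u)\,dx\,dy\,dz,\qquad q(u)=\frac{\Gamma(5/2-u)}{\pi^{3/2}\,\Gamma(1-u)\,(1-x^2-y^2-z^2)^u}.$$ The relative entropy of a density matrix $\rho_1$ with respect to a density matrix $\rho_2$ is $S(\rho_1,\rho_2)=\operatorname{Tr}\rho_1(\log\rho_1-\log\rho_2)$; $\log$ is the natural logarithm and $0\log0=0$. For $r=0$ the formula is understood as its limit for $r\downarrow0$. *)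

(* Defs.v *)
From HB Require Import structures.
From mathcomp Require Import all_boot all_order all_algebra.
From mathcomp Require Import all_classical all_reals all_analysis.
From mathcomp Require Import spectral complex mxtens.
Import Order.TTheory GRing.Theory Num.Theory numFieldNormedType.Exports.

Set Implicit Arguments.
Unset Strict Implicit.
Unset Printing Implicit Defensive.

Local Open Scope classical_set_scope.
Local Open Scope complex_scope.
Local Open Scope ring_scope.

(* Euler's integral: meaningful for 0 < s, the only arguments used below. *)
Definition Gamma (R : realType) (s : R) : R :=
  \int[@lebesgue_measure R]_(t in `]0, +oo[) (t `^ (s - 1) * expR (- t)).

Definition unit_ball3 (R : realType) :
    set (measurableTypeR R * measurableTypeR R * measurableTypeR R) :=
  [set p | (p.1.1 : R) ^+ 2 + (p.1.2 : R) ^+ 2 + (p.2 : R) ^+ 2 <= 1].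

Definition bloch_state (R : realType) (x y z : R) : 'M[R[i]]_2 :=
  2^-1 *: \matrix_(i < 2, j < 2)
    nth 0 (nth [::] [:: [:: (1 + z) +i* 0; x -i* y      ];
                        [:: x +i* y      ; (1 - z) +i* 0]] i) j.

Definition prior_density (R : realType) (u x y z : R) : R :=
  Gamma (5 / 2 - u) /
  (pi `^ (3 / 2) * Gamma (1 - u) * (1 - x ^+ 2 - y ^+ 2 - z ^+ 2) `^ u).

Definition mx_integral (R : realType) (d : measure_display)
    (T : measurableType d) (mu : {measure set T -> \bar R}) (D : set T)
    (m n : nat) (F : T -> 'M[R[i]]_(m, n)) : 'M[R[i]]_(m, n) :=
  \matrix_(i, j) ((\int[mu]_(p in D) complex.Re (F p i j)) +i*
                  (\int[mu]_(p in D) complex.Im (F p i j))).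

Definition zeta (R : realType) (n : nat) (u : R) : 'M[R[i]]_(2 ^ n) :=
  mx_integral (@lebesgue_measure R \x @lebesgue_measure R \x @lebesgue_measure R)%E
    (@unit_ball3 R) (fun p =>
    (prior_density u p.1.1 p.1.2 p.2)%:C *:
      ntensmx (bloch_state p.1.1 p.1.2 p.2) n).

(* Functional calculus for Hermitian A: A = P^-1 *m diag_mx D *m P with P
   unitary and D real. Zero eigenvalues are sent to 0, because ln 0 = 0. *)
Definition log_mx (R : realType) (m : nat) (A : 'M[R[i]]_m) : 'M[R[i]]_m :=
  invmx (spectralmx A) *m
  diag_mx (map_mx (fun a => (ln (complex.Re a))%:C) (spectral_diag A)) *m
  spectralmx A.

(* For density matrices. If the kernel of rho2 is not contained in that of
   rho1, then - Tr (rho1 log rho2) is +oo; otherwise log_mx's value 0 at the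
   eigenvalue 0 implements 0 log 0 = 0 in both terms. Row kernels may be used
   because both matrices are Hermitian, and for the same reason the trace is
   real. *)
Definition relative_entropy (R : realType) (m : nat) (rho1 rho2 : 'M[R[i]]_m) :
    \bar R :=
  if (kermx rho2 <= kermx rho1)%MS
  then (complex.Re (\tr (rho1 *m (log_mx rho1 - log_mx rho2))))%:E
  else +oo%E.

Definition zeta_eigenvalue (R : realType) (n : nat) (u : R) (d : nat) : R :=
  1 / 2 ^+ n *
  ((Gamma (5 / 2 - u) * Gamma (2 + n%:R - d%:R - u) * Gamma (1 + d%:R - u)) /
   (Gamma (5 / 2 + n%:R / 2 - u) * Gamma (2 + n%:R / 2 - u) * Gamma (1 - u))).

(* Only meaningful for r != 0. *)
Definition entropy_formula (R : realType) (n : nat) (u r : R) : R :=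
  n%:R / 2 * (1 - r) * ln ((1 - r) / 2) + n%:R / 2 * (1 + r) * ln ((1 + r) / 2)
  - \sum_(0 <= d < n./2.+1)
      (n - 2 * d + 1)%:R / (n + 1)%:R * 'C(n + 1, d)%:R
      * (1 / (2 ^+ (n + 1) * r))
      * ((1 + r) ^+ (n - d + 1) * (1 - r) ^+ d
         - (1 + r) ^+ d * (1 - r) ^+ (n - d + 1))
      * ln (zeta_eigenvalue n u d).

(* Main.v *)
From HB Require Import structures.
Require Import Defs.
From mathcomp Require Import all_boot all_order all_algebra.
From mathcomp Require Import all_classical all_reals all_analysis.
From mathcomp Require Import spectral complex mxtens.
From mathcomp Require Import measurable_realfun ring lra zify.
Import Order.TTheory GRing.Theory Num.Theory numFieldNormedType.Exports.
Set Implicit Arguments.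
Unset Strict Implicit.
Unset Printing Implicit Defensive.
Local Open Scope classical_set_scope.
Local Open Scope ring_scope.

(* Iterating C^2 (x) Sym^k = Sym^(k+1) (+) det (x) Sym^(k-1) splits the n-th
   tensor power of C^2 into copies of det^d (x) Sym^(n-2d), the number of copies
   being the ballot number C(n,d) - C(n,d-1). On each of them zeta_n(u) is the
   average of det(rho)^d Sym^(n-2d)(rho). This average is a scalar: evaluated on
   the vectors (1,a,a^2,...) and (1,b,b^2,...) it is the mean of the power
   (c + w.p)^k times (1 - |p|^2)^d, up to a constant, where w.w = c^2, and since
   the density is rotation invariant this depends on w through w.w only, so it
   is proportional to c^k = (1 + a b)^k. The scalar, lambda_d, follows from the
   even moments of the density, which are quotients of Gamma values (Dirichlet's
   integral). Hence Tr (rho^(x n) log zeta_n(u)) is the sum over d of log lambda_d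
   times the trace of rho^(x n) on the blocks of index d, while
   Tr (rho^(x n) log rho^(x n)) is n times the one-particle term. *)

(** * Decomposition of the tensor powers of C^2 *)

(** The logarithm of a matrix is defined through an unspecified unitary diagonalization, which is
    hard to follow through tensor powers and blocks. It is replaced by an interpolating polynomial:
    polynomials pass through intertwiners, and their traces reduce to traces of powers, which depend
    on rho only through its trace and determinant. Hence no eigenvectors are computed, and the
    blocks need not be orthogonal: inclusions, left inverses and a resolution of the identity
    suffice. The vector w met when averaging Sym^(n-2d)(rho) is complex, so no rotation of the ball
    moves it to an axis. Rotation invariance is used in algebraic form instead: every moment of the
    density is a product of one-dimensional Gaussian moments and a factor that depends on the total
    degree only, and Gaussian moments obey a convolution rule. The integrals over the ball are done
    one coordinate at a time, without polar coordinates: a factor e^(-t) and an exchange of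
    integrals turn each slice into a quotient of Gamma values. *)

Section SymmetricPower.
Variable F : numFieldType.
Implicit Types (M : 'M[F]_2) (k : nat).

Definition row_poly M (a : 'I_2) : {poly F} := (M a 0)%:P + M a 1 *: 'X.

(* [Sym^k M] in the monomial basis: its row [j] lists the coefficients of
   [(M 0 0 + M 0 1 X)^(k-j) (M 1 0 + M 1 1 X)^j]. *)
Definition sympow_poly k M (j : nat) : {poly F} :=
  row_poly M 0 ^+ (k - j) * row_poly M 1 ^+ j.

Definition sympow k M : 'M[F]_k.+1 := \matrix_(j, l) (sympow_poly k M j)`_l.

(* The Clebsch-Gordan maps: [cg_up] and [cg_down] are the inclusions of
   [Sym^(k+1)] into [C^2 (x) Sym^k] and of [det (x) Sym^k] into
   [C^2 (x) Sym^(k+1)] (for column vectors), and [cg_up_inv], [cg_down_inv] the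
   corresponding projections. *)
Definition cg_up k : 'M[F]_(2 * k.+1, k.+2) := \matrix_(i, l)
  let: (a, j) := @mxtens_unindex 2 k.+1 i in (l == a + j :> nat)%N%:R.

Definition cg_up_inv k : 'M[F]_(k.+2, 2 * k.+1) := \matrix_(l, i)
  let: (a, j) := @mxtens_unindex 2 k.+1 i in
  (l == a + j :> nat)%N%:R * (if a == 0 then k.+1%:R - l%:R else l%:R) / k.+1%:R.

Definition cg_down k : 'M[F]_(2 * k.+2, k.+1) := \matrix_(i, l)
  let: (a, j) := @mxtens_unindex 2 k.+2 i in
  if a == 0 then (j == l.+1 :> nat)%:R * l.+1%:R
  else - ((j == l :> nat)%:R * (k.+1%:R - l%:R)).

Definition cg_down_inv k : 'M[F]_(k.+1, 2 * k.+2) := \matrix_(l, i)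
  let: (a, j) := @mxtens_unindex 2 k.+2 i in
  if a == 0 then (j == l.+1 :> nat)%:R / k.+2%:R
  else - ((j == l :> nat)%:R / k.+2%:R).

Lemma sum_delta n (f : nat -> F) c :
  \sum_(m < n) f m * (m == c :> nat)%:R = if (c < n)%N then f c else 0.
Proof.
case: ifPn => cn.
  rewrite (bigD1 (Ordinal cn)) //= eqxx mulr1 big1 ?addr0 // => i ic.
  by rewrite (_ : (_ == c) = false) ?mulr0 //; exact: negbTE.
rewrite big1 // => i _; rewrite (_ : (_ == c) = false) ?mulr0 //.
by apply/negbTE; apply: contraNneq cn => <-.
Qed.

Lemma sum_mxtens m n (f : 'I_(m * n) -> F) :
  \sum_i f i = \sum_(a < m) \sum_(j < n) f (mxtens_index (a, j)).
Proof.
rewrite pair_big (reindex (@mxtens_index m n)) /=.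
  by apply: eq_bigr => -[a j] _.
by exists (@mxtens_unindex m n) => i _; rewrite ?mxtens_indexK ?mxtens_unindexK.
Qed.

Lemma sum_mxtens2 n (f : 'I_(2 * n) -> F) :
  \sum_i f i =
  \sum_(j < n) f (mxtens_index (0, j)) + \sum_(j < n) f (mxtens_index (1, j)).
Proof.
rewrite sum_mxtens big_ord_recl big_ord1 /=; congr (_ + _).
by apply: eq_bigr => j _; congr (f (mxtens_index (_, _))); apply: val_inj.
Qed.

Lemma ord2P (a : 'I_2) : a = 0 \/ a = 1.
Proof. by case: a => [[|[|]]] //= ?; [left | right]; apply: val_inj. Qed.

Lemma size_row_poly M a : (size (row_poly M a) <= 2)%N.
Proof.
rewrite (leq_trans (size_polyD _ _)) // geq_max (leq_trans (size_polyC_leq1 _)) //=.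
by rewrite (leq_trans (size_scale_leq _ _)) // size_polyX.
Qed.

Lemma size_sympow_poly k M j : (j <= k)%N -> (size (sympow_poly k M j) <= k.+1)%N.
Proof.
move=> jk; rewrite (leq_trans (size_polyMleq _ _)) //.
have H a e : (size (row_poly M a ^+ e) <= e.+1)%N.
  rewrite (leq_trans (size_poly_exp_leq _ _)) // ltnS.
  have := size_row_poly M a; case: (size _) => [|[|[|]]] //=; lia.
have := H 0 (k - j)%N; have := H 1 j; lia.
Qed.

Lemma coef_row_polyM M a (p : {poly F}) l :
  (row_poly M a * p)`_l = M a 0 * p`_l + M a 1 * (if l is l'.+1 then p`_l' else 0).
Proof.
rewrite mulrDl coefD mul_polyC coefZ -scalerAl coefZ coefXM.
by case: l.
Qed.

Lemma sympow1 M : sympow 1 M = M.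
Proof.
apply/matrixP => i j; rewrite mxE /sympow_poly.
have E a : (row_poly M a)`_j = M a j.
  rewrite coefD coefC coefZ coefX.
  by case: j => [[|[|]]] //= ?; rewrite ?mulr0 ?mulr1 ?addr0 ?add0r; congr (M _ _); apply: val_inj.
case: i => [[|[|]]] //= ?; rewrite ?expr0 ?expr1 ?mulr1 ?mul1r E; congr (M _ _); exact: val_inj.
Qed.

(** Acting on rows from the right, [cg_up] multiplies polynomials: row (a, j) of either side lists
    the coefficients of [row_poly M a * sympow_poly k M j], which is
    [sympow_poly k.+1 M (a + j)]. *)
Lemma cg_up_intertwines k M :
  (M *t sympow k M) *m cg_up k = cg_up k *m sympow k.+1 M.
Proof.
apply/matrixP => i l; case: (mxtens_indexP i) => a j {i}.
rewrite !mxE sum_mxtens2.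
under eq_bigr => m _ do
  rewrite tensmxE !mxE !mxtens_indexK /= -mulrA add0n eq_sym.
under [X in _ + X]eq_bigr => m _ do
  rewrite tensmxE !mxE !mxtens_indexK /= -mulrA add1n eq_sym.
rewrite -!mulr_sumr (sum_delta _ (fun m => (sympow_poly k M j)`_m)).
have jk := ltn_ord j.
transitivity ((row_poly M a * sympow_poly k M j)`_l).
  rewrite coef_row_polyM; congr (_ + _).
    congr (_ * _); case: ltnP => // h.
    by rewrite nth_default // (leq_trans (size_sympow_poly _ _)) // -ltnS.
  case: l => [[|l]] hl /=; first by rewrite big1 ?mulr0 // => ? _; rewrite mulr0.
  under eq_bigr => m _ do rewrite eqSS.
  by rewrite (sum_delta _ (fun m => (sympow_poly k M j)`_m)) -ltnS hl.
under [RHS]eq_bigr => m _ do rewrite !mxE !mxtens_indexK /= mulrC.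
rewrite (sum_delta _ (fun m => (sympow_poly k.+1 M m)`_l)).
case: (ord2P a) => -> /=.
  by rewrite add0n ltnS (ltnW jk) /sympow_poly subSn // exprS mulrA.
by rewrite add1n ltnS jk /sympow_poly subSS exprS mulrCA.
Qed.

Lemma cg_up_invK k : cg_up_inv k *m cg_up k = 1%:M.
Proof.
have k0 : k.+1%:R != 0 :> F by rewrite pnatr_eq0.
apply/matrixP => l l'; rewrite !mxE sum_mxtens2.
transitivity ((l == l' :> nat)%:R * ((k.+1%:R - l%:R) / k.+1%:R) +
              (l == l' :> nat)%:R * (l%:R / k.+1%:R) : F); last first.
  by rewrite -mulrDr -mulrDl subrK divff // mulr1.
congr (_ + _).
  transitivity (\sum_(j < k.+1) (l' == j :> nat)%:R *
      ((k.+1%:R - l%:R) / k.+1%:R) * (j == l :> nat)%:R : F).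
    apply: eq_bigr => j _; rewrite !mxE !mxtens_indexK /= add0n (eq_sym (j : nat)).
    by ring.
  rewrite (sum_delta _
    (fun j => (l' == j :> nat)%:R * ((k.+1%:R - l%:R) / k.+1%:R))) eq_sym.
  (* For l = k+1 there is no index j = l, but then the weight k+1-l vanishes; l = 0 plays the same
     part in the second sum. *)
  case: ltnP => // h; have -> : l = k.+1 :> nat by have := ltn_ord l; lia.
  by rewrite subrr mul0r mulr0.
case: l => [[|l]] hl /=.
  rewrite mul0r mulr0 big1 // => j _; rewrite !mxE !mxtens_indexK /=.
  by rewrite mulr0 !mul0r.
transitivity (\sum_(j < k.+1) (l' == j.+1 :> nat)%:R *
    (l.+1%:R / k.+1%:R) * (j == l :> nat)%:R : F).
  apply: eq_bigr => j _; rewrite !mxE !mxtens_indexK /= add1n eqSS (eq_sym l).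
  by ring.
rewrite (sum_delta _
    (fun j => (l' == j.+1 :> nat)%:R * (l.+1%:R / k.+1%:R))) eq_sym.
by rewrite -ltnS hl.
Qed.

Lemma cg_down_invK k : cg_down_inv k *m cg_down k = 1%:M.
Proof.
have k0 : k.+2%:R != 0 :> F by rewrite pnatr_eq0.
apply/matrixP => l l'; rewrite !mxE sum_mxtens2.
have hl := ltn_ord l.
transitivity ((l == l' :> nat)%:R * (l.+1%:R / k.+2%:R) +
              (l == l' :> nat)%:R * ((k.+1%:R - l%:R) / k.+2%:R) : F); last first.
  have E : k.+2%:R = l.+1%:R + (k.+1%:R - l%:R) :> F.
     rewrite -[l.+1]addn1 -[k.+2]addn1 !natrD; ring.
  by rewrite -mulrDr -mulrDl -E divff // mulr1.
congr (_ + _).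
  transitivity (\sum_(j < k.+2) (l'.+1 == j :> nat)%:R *
      (l'.+1%:R / k.+2%:R) * (j == l.+1 :> nat)%:R : F).
    apply: eq_bigr => j _; rewrite !mxE !mxtens_indexK /= (eq_sym (j : nat) l'.+1).
    by ring.
  rewrite (sum_delta _
    (fun j => (l'.+1 == j :> nat)%:R * (l'.+1%:R / k.+2%:R))) ltnS hl eqSS.
  by rewrite (eq_sym (l : nat)); case: eqP => [->|]; rewrite ?mul0r.
transitivity (\sum_(j < k.+2) (l' == j :> nat)%:R *
    ((k.+1%:R - l'%:R) / k.+2%:R) * (j == l :> nat)%:R : F).
  apply: eq_bigr => j _; rewrite !mxE !mxtens_indexK /= (eq_sym (j : nat) l').
  by ring.
rewrite (sum_delta _
  (fun j => (l' == j :> nat)%:R * ((k.+1%:R - l'%:R) / k.+2%:R))) ltnS (ltnW hl).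
by rewrite (eq_sym (l : nat)); case: eqP => [->|]; rewrite ?mul0r.
Qed.

(** C^2 (x) Sym^0 is Sym^1, with no [det] summand: both matrices are 2 by 2, so a left inverse is a
    right inverse. *)
Lemma cg_up0_inv : cg_up 0 *m cg_up_inv 0 = 1%:M.
Proof. by apply: mulmx1C; exact: cg_up_invK. Qed.

Lemma cg_sum k :
  cg_up k.+1 *m cg_up_inv k.+1 + cg_down k *m cg_down_inv k = 1%:M.
Proof.
have k0 : k.+2%:R != 0 :> F by rewrite pnatr_eq0.
apply/matrixP => i i'; case: (mxtens_indexP i) => a j {i}.
case: (mxtens_indexP i') => b j' {i'}; rewrite !mxE.
have hj := ltn_ord j; have hj' := ltn_ord j'; have ha := ltn_ord a.
(* Each sum over l collapses to at most one term. In the second, l may be out of range, at a = 0, j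
   = 0 and at a = 1, j = k+1; the coefficients j and k+1-j vanish exactly there. *)
transitivity ((a + j == b + j')%N%:R *
    (if b == 0 then k.+2%:R - (a + j)%N%:R else (a + j)%N%:R) / k.+2%:R +
    (if a == 0 then j%:R else - (k.+1%:R - j%:R)) *
    (if b == 0 then (j' == a + j :> nat)%N%:R / k.+2%:R
     else - ((j'.+1 == a + j)%N%:R / k.+2%:R)) : F); last first.
  have kE : k.+1%:R = k.+2%:R - 1 :> F by rewrite -[k.+2]addn1 natrD addrK.
  rewrite (can_eq (@mxtens_indexK _ _)) xpair_eqE.
  case: (ord2P a) => ->; case: (ord2P b) => -> /=.
  - rewrite !add0n (eq_sym (j' : nat)) (_ : (j == j' :> nat) = (j == j')) //.
    by move: (k.+2%:R) k0 => K K0; field.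
  - by rewrite add0n add1n (eq_sym (j : nat)); ring.
  - rewrite add0n add1n (eq_sym (j' : nat)) kE -[j.+1]addn1 natrD.
    by ring.
  - rewrite !add1n !eqSS (eq_sym (j' : nat)) (_ : (j == j' :> nat) = (j == j')) //.
    rewrite kE; move: (k.+2%:R) k0 => K K0.
    by rewrite -[j.+1]addn1 natrD; field.
congr (_ + _).
  transitivity (\sum_(l < k.+3) ((l == b + j' :> nat)%N%:R *
      (if b == 0 then k.+2%:R - l%:R else l%:R) / k.+2%:R) *
      (l == a + j :> nat)%N%:R : F).
    by apply: eq_bigr => l _; rewrite !mxE !mxtens_indexK /= mulrC.
  rewrite (sum_delta _ (fun l => (l == b + j' :> nat)%N%:R *
      (if b == 0 then k.+2%:R - l%:R else l%:R) / k.+2%:R)).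
  by rewrite ifT //; lia.
case: (ord2P a) => -> /=.
  case: j hj => [[|j] hj0 hj] /=.
    rewrite mul0r big1 // => l _; rewrite !mxE !mxtens_indexK /=.
    by rewrite !mul0r.
  transitivity (\sum_(l < k.+1) (l.+1%:R *
      (if b == 0 then (j' == l.+1 :> nat)%N%:R / k.+2%:R
     else - ((j' == l :> nat)%N%:R / k.+2%:R))) * (l == j :> nat)%:R : F).
    apply: eq_bigr => l _; rewrite !mxE !mxtens_indexK /= eqSS (eq_sym j).
    by ring.
  rewrite (sum_delta _ (fun l => (l.+1%:R *
      (if b == 0 then (j' == l.+1 :> nat)%N%:R / k.+2%:R
     else - ((j' == l :> nat)%N%:R / k.+2%:R))))).
  by rewrite -ltnS hj add0n eqSS.
transitivity (\sum_(l < k.+1) (- (k.+1%:R - l%:R) *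
      (if b == 0 then (j' == l.+1 :> nat)%N%:R / k.+2%:R
     else - ((j' == l :> nat)%N%:R / k.+2%:R))) * (l == j :> nat)%:R : F).
  apply: eq_bigr => l _; rewrite !mxE !mxtens_indexK /= (eq_sym (j : nat)).
  by ring.
rewrite (sum_delta _ (fun l => (- (k.+1%:R - l%:R) *
      (if b == 0 then (j' == l.+1 :> nat)%N%:R / k.+2%:R
     else - ((j' == l :> nat)%N%:R / k.+2%:R))))) add1n eqSS.
case: ltnP => // h; have -> : j = k.+1 :> nat by lia.
by rewrite subrr oppr0 mul0r.
Qed.

Lemma det_mx2E M : \det M = M 0 0 * M 1 1 - M 0 1 * M 1 0.
Proof.
rewrite (expand_det_row _ 0) big_ord_recl big_ord1 /cofactor !det_mx11 !mxE /=.
rewrite expr0 expr1 mul1r mulN1r mulrN (_ : lift 0 _ = 1); last exact: val_inj.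
by rewrite (_ : lift 1 _ = 0) //; apply: val_inj.
Qed.

(** On rows, [cg_down] is the first transvectant (the Jacobian) of a linear form f and a form of
    degree k+1. Written with the dehomogenized polynomials f and P it is f P' - (k+1) f' P, and
    Jacobians pick up the determinant under a linear substitution. *)
Lemma cg_down_intertwines k M :
  (M *t sympow k.+1 M) *m cg_down k = \det M *: (cg_down k *m sympow k M).
Proof.
apply/matrixP => i l; case: (mxtens_indexP i) => a j {i}.
rewrite !mxE sum_mxtens2.
pose P := sympow_poly k.+1 M j; have hl := ltn_ord l; have hj := ltn_ord j.
transitivity ((row_poly M a * P^`() - k.+1%:R *: (M a 1 *: P))`_l).
  transitivity (\sum_(m < k.+2) (M a 0 * P`_m * l.+1%:R) * (m == l.+1 :> nat)%:R
    + \sum_(m < k.+2) (- (M a 1 * P`_m * (k.+1%:R - l%:R))) * (m == l :> nat)%:R).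
    congr (_ + _); apply: eq_bigr => m _; rewrite tensmxE !mxE !mxtens_indexK /= -/P; ring.
  rewrite (sum_delta _ (fun m => M a 0 * P`_m * l.+1%:R)).
  rewrite (sum_delta _ (fun m => - (M a 1 * P`_m * (k.+1%:R - l%:R)))).
  rewrite ltnS hl ltnS (ltnW hl) coefB coef_row_polyM !coefZ coef_deriv.
  rewrite -(mulr_natr P`_l.+1).
  case: (nat_of_ord l) => [|l']; last rewrite coef_deriv -(mulr_natr P`_l'.+1).
    by ring.
  by ring.
under eq_bigr => m _ do rewrite !mxE !mxtens_indexK /=.
have dA c : (row_poly M c)^`() = (M c 1)%:P.
  by rewrite derivD derivC add0r derivZ derivX alg_polyC.
have detE : (M 1 1)%:P * row_poly M 0 - (M 0 1)%:P * row_poly M 1 = (\det M)%:P.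
  by rewrite det_mx2E /row_poly -!mul_polyC !polyCB !polyCM; ring.
pose e := (k.+1 - j)%N.
have eE : (k.+1%:R - j%:R) = e%:R :> F by rewrite natrB.
have kE : k.+1%:R = e%:R + j%:R :> F by rewrite -eE subrK.
have dP : P^`() = e%:R * ((M 0 1)%:P * row_poly M 0 ^+ e.-1 * row_poly M 1 ^+ j)
    + j%:R * ((M 1 1)%:P * row_poly M 0 ^+ e * row_poly M 1 ^+ j.-1).
  rewrite derivM.
  have dX c m : (row_poly M c ^+ m)^`() =
      m%:R * ((M c 1)%:P * row_poly M c ^+ m.-1) by rewrite deriv_exp dA mulr_natl.
  by rewrite !dX -/e; ring.
have sE x : k.+1%:R *: (x *: P) = (e%:R + j%:R) * (x%:P * P).
  by rewrite kE -!mul_polyC polyCD !polyC_natr.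
rewrite sE.
have PE : P = row_poly M 0 ^+ e * row_poly M 1 ^+ j by [].
have nat_mul (m : nat) (p : {poly F}) : (m%:R * p)`_l = m%:R * p`_l.
  by rewrite -polyC_natr coefCM.
(* Valid at n = 0 too, where [n.-1] is 0 but the factor n kills both sides; this avoids splitting on
   the exponents e and j. *)
have natX n (p : {poly F}) : n%:R * p ^+ n = n%:R * p ^+ n.-1 * p.
  by case: n => [|n]; rewrite ?mul0r // exprSr mulrA.
have eX := natX e (row_poly M 0); have jX := natX j (row_poly M 1).
rewrite dP {1}PE -/e.
set A := row_poly M 0 in detE eX *; set B := row_poly M 1 in detE jX *.
set A' := (M 0 1)%:P in detE *; set B' := (M 1 1)%:P in detE *.
case: (ord2P a) => -> /=.
  (* With A, B the two rows, the terms in e cancel, and j A^e B^(j-1) (B' A - A' B) is left; the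
     bracket is the determinant. *)
  transitivity (\det M * (j%:R * (sympow_poly k M j.-1)`_l)).
    rewrite -nat_mul -coefCM -detE; congr (polyseq _)`_l.
    have -> : j%:R * sympow_poly k M j.-1 = j%:R * (A ^+ e * B ^+ j.-1).
      rewrite /sympow_poly /e; case: (nat_of_ord j) => [|j']; first by rewrite !mul0r.
      by rewrite subSS.
    rewrite -/A -/A'.
    transitivity (A' * B ^+ j * (e%:R * A ^+ e.-1 * A - e%:R * A ^+ e)
       + j%:R * B' * A ^+ e * A * B ^+ j.-1 - A' * A ^+ e * (j%:R * B ^+ j)).
      by ring.
    by rewrite eX jX; ring.
  congr (_ * _); move: hj; case: (nat_of_ord j) => [|j'] hj /=.
    by rewrite mul0r big1 // => m _; rewrite mul0r mul0r.
  transitivity (\sum_(m < k.+1) (j'.+1%:R * (sympow_poly k M m)`_l) *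
       (m == j' :> nat)%:R).
    by rewrite (sum_delta _ (fun m => j'.+1%:R * (sympow_poly k M m)`_l)) -ltnS hj.
  apply: eq_bigr => m _; rewrite eqSS (eq_sym j'); case: eqP => [->|_] /=; by ring.
transitivity (\det M * - (e%:R * (sympow_poly k M j)`_l)).
  rewrite -nat_mul -coefN -coefCM -detE; congr (polyseq _)`_l.
  have -> : e%:R * sympow_poly k M j = e%:R * (A ^+ e.-1 * B ^+ j).
    by rewrite /sympow_poly /e; congr (_ * (_ ^+ _ * _)); lia.
  rewrite -/B -/B'.
  transitivity (A' * B ^+ j * B * (e%:R * A ^+ e.-1) - B' * B ^+ j * (e%:R * A ^+ e)
       + B' * A ^+ e * (j%:R * B ^+ j.-1 * B - j%:R * B ^+ j)).
    by ring.
  by rewrite eX jX; ring.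
congr (_ * _).
transitivity (\sum_(m < k.+1) (- (k.+1%:R - m%:R) * (sympow_poly k M m)`_l) *
       (m == j :> nat)%:R).
  rewrite (sum_delta _ (fun m => - (k.+1%:R - m%:R) * (sympow_poly k M m)`_l)).
  case: ltnP => h; first by rewrite eE mulNr.
  by rewrite /e (_ : (k.+1 - j)%N = 0%N) ?mul0r ?oppr0 //; lia.
by apply: eq_bigr => m _; rewrite (eq_sym (j : nat)); ring.
Qed.

End SymmetricPower.

Section Blocks.
Variable F : numFieldType.
Implicit Types (M : 'M[F]_2) (k n : nat).

Lemma mxtrace_tensmx m n (A : 'M[F]_m) (B : 'M[F]_n) :
  \tr (A *t B) = \tr A * \tr B.
Proof.
rewrite /mxtrace sum_mxtens mulr_suml; apply: eq_bigr => a _.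
by rewrite mulr_sumr; apply: eq_bigr => j _; rewrite tensmxE.
Qed.

(** Trace of [M *t sympow k.+1 M] cut by the resolution of the identity [cg_sum]; cyclicity removes
    the Clebsch-Gordan maps. *)
Lemma mxtrace_sympow_rec k M :
  \tr (sympow k.+2 M) = \tr M * \tr (sympow k.+1 M) - \det M * \tr (sympow k M).
Proof.
apply/eqP; rewrite eq_sym subr_eq -mxtrace_tensmx.
rewrite -[M *t _]mulmx1 -cg_sum mulmxDr !mulmxA raddfD /=.
rewrite cg_up_intertwines cg_down_intertwines -scalemxAl mxtraceZ.
rewrite -!mulmxA mxtrace_mulC -mulmxA cg_up_invK mulmx1.
by rewrite [X in _ * X]mxtrace_mulC -mulmxA cg_down_invK mulmx1.
Qed.

(** The complete homogeneous polynomials in a and b obey the same two-step recurrence, so the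
    induction carries two consecutive degrees. *)
Lemma mxtrace_sympow k M a b : \tr M = a + b -> \det M = a * b ->
  \tr (sympow k M) = \sum_(i < k.+1) a ^+ (k - i) * b ^+ i.
Proof.
move=> trM detM.
have [] : \tr (sympow k M) = \sum_(i < k.+1) a ^+ (k - i) * b ^+ i /\
  \tr (sympow k.+1 M) = \sum_(i < k.+2) a ^+ (k.+1 - i) * b ^+ i; last by [].
elim: k => [|k [IH0 IH1]].
  rewrite sympow1 trM !big_ord_recl !big_ord0 /= /mxtrace big_ord1 mxE.
  by rewrite /sympow_poly /bump /= ?subn0 ?subnn ?expr0 ?expr1 ?mulr1 ?mul1r ?coef1 ?addr0.
split=> //; rewrite mxtrace_sympow_rec IH0 IH1 trM detM.
have S (m : nat) : \sum_(i < m.+2) a ^+ (m.+1 - i) * b ^+ i =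
    a * (\sum_(i < m.+1) a ^+ (m - i) * b ^+ i) + b ^+ m.+1.
  rewrite big_ord_recr /= subnn expr0 mul1r; congr (_ + _).
  rewrite mulr_sumr; apply: eq_bigr => i _.
  by rewrite subSn -1?ltnS // exprS mulrA.
by rewrite (S k.+1) (S k) !exprS; ring.
Qed.

(* A copy of [det^d (x) Sym^k] in the tensor power, given by its inclusion
   [block_in] and a projection [block_out] onto it. *)
Record block N := Block {
  block_deg : nat;
  block_ord : nat;
  block_in : 'M[F]_(N, block_ord.+1);
  block_out : 'M[F]_(block_ord.+1, N) }.

(** One [block_in] serves all matrices [M]; this is what allows the relation to be averaged over the
    states. *)
Definition valid_block n (b : block (2 ^ n)) : Prop :=
  [/\ n = (block_deg b + block_deg b + block_ord b)%N,
      block_out b *m block_in b = 1%:M &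
      forall M, ntensmx M n *m block_in b =
        \det M ^+ block_deg b *: (block_in b *m sympow (block_ord b) M)].

Definition block_proj N (b : block N) : 'M[F]_N := block_in b *m block_out b.

Definition up_block N (b : block N) : block (2 * N) :=
  Block (block_deg b) ((1%:M *t block_in b) *m cg_up _ _)
    (cg_up_inv _ _ *m (1%:M *t block_out b)).

Definition sub_blocks N (b : block N) : seq (block (2 * N)) :=
  let: Block d k U T := b in
  match k return 'M[F]_(N, k.+1) -> 'M[F]_(k.+1, N) -> seq (block (2 * N)) with
  | 0 => fun U T => [:: up_block (Block d U T)]
  | k.+1 => fun U T => [:: up_block (Block d U T);
      Block d.+1 ((1%:M *t U) *m cg_down _ k) (cg_down_inv _ k *m (1%:M *t T))]
  end U T.

Lemma tensmx1l_proj m n k (U : 'M[F]_(n, k)) (T : 'M[F]_(k, n)) p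
   (C : 'M[F]_(m * k, p)) (D : 'M[F]_(p, m * k)) :
  ((1%:M *t U) *m C) *m (D *m (1%:M *t T)) = (1%:M *t U) *m (C *m D) *m (1%:M *t T).
Proof. by rewrite !mulmxA. Qed.

Lemma tensmx11 m n : 1%:M *t 1%:M = 1%:M :> 'M[F]_(m * n).
Proof.
apply/matrixP => i i'; case: (mxtens_indexP i) => a j.
case: (mxtens_indexP i') => b j'.
by rewrite tensmxE !mxE (can_eq (@mxtens_indexK _ _)) xpair_eqE -natrM mulnb.
Qed.

Lemma sub_blocks_proj N (b : block N) :
  \sum_(c <- sub_blocks b) block_proj c = 1%:M *t block_proj b.
Proof.
case: b => d [|k] U T /=; rewrite !big_cons big_nil ?addr0 /block_proj /=.
  by rewrite tensmx1l_proj cg_up0_inv mulmx1 tensmx_mul mulmx1.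
rewrite !tensmx1l_proj -mulmxDl -mulmxDr cg_sum mulmx1 tensmx_mul mulmx1 //.
Qed.

Lemma sub_blocks_sum N (b : block N) (g : nat -> F) :
  \sum_(c <- sub_blocks b) g (block_deg c) =
  g (block_deg b) + (0 < block_ord b)%N%:R * g (block_deg b).+1.
Proof.
case: b => d [|k] U T /=; rewrite !big_cons big_nil /= ?mul0r ?mul1r ?addr0 //.
Qed.

Lemma tens_intertwines n M d k (U : 'M[F]_(2 ^ n.+1, k.+1)) p e q
   (C : 'M[F]_(2 * k.+1, p)) (S : 'M[F]_p) :
  ntensmx M n.+1 *m U = d *: (U *m sympow k M) ->
  (M *t sympow k M) *m C = e *: (C *m S) -> q = d * e ->
  (ntensmx M n.+2 : 'M[F]_(2 * 2 ^ n.+1)) *m ((1%:M *t U) *m C) = q *: (((1%:M *t U) *m C) *m S).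
Proof.
move=> HU HC ->; rewrite mulmxA ntensmxSS tensmx_mul mulmx1 HU.
have -> : M *t (d *: (U *m sympow k M)) =
    d *: ((1%:M *t U) *m (M *t sympow k M)).
  rewrite tensmx_mul mul1mx; apply/matrixP => i j.
  by rewrite !mxE; ring.
by rewrite -scalemxAl -!mulmxA HC -scalemxAr scalerA.
Qed.

Lemma sub_blocks_valid n (b : block (2 ^ n.+1)) : valid_block b ->
  all (fun c => `[< @valid_block n.+2 c >]) (sub_blocks b).
Proof.
have Hup : valid_block b -> @valid_block n.+2 (up_block b).
  case: b => d k U T [/= nE TU HU]; split => /=.
  - by rewrite nE addnS.
  - rewrite -mulmxA [X in _ *m X]mulmxA tensmx_mul TU mulmx1 tensmx11 mul1mx.
    exact: cg_up_invK.
  - move=> M; apply: (@tens_intertwines _ _ (\det M ^+ d) _ _ _ 1) => //.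
      by rewrite cg_up_intertwines scale1r.
    by rewrite mulr1.
case: b Hup => d [|k] U T Hup vb /=; rewrite ?andbT.
  by apply/asboolP; apply: Hup.
apply/andP; split; apply/asboolP; first by apply: Hup.
case: vb => /= nE TU HU; split => /=.
- by rewrite nE; lia.
- rewrite -mulmxA [X in _ *m X]mulmxA tensmx_mul TU mulmx1 tensmx11 mul1mx.
  exact: cg_down_invK.
- move=> M; apply: (@tens_intertwines _ _ (\det M ^+ d) _ _ _ (\det M)) => //.
    exact: cg_down_intertwines.
  by rewrite exprSr.
Qed.

(* The multiplicity of [det^d (x) Sym^(n-2d)]. *)
Definition ballot n d : F := 'C(n, d)%:R - (if d is d'.+1 then 'C(n, d')%:R else 0).

(** The bound on d keeps the natural subtraction exact; the rest is Pascal's rule and the absorption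
    identity. *)
Lemma ballotE n d : (d + d <= n)%N ->
  ballot n d = (n - 2 * d + 1)%:R / (n + 1)%:R * 'C(n + 1, d)%:R.
Proof.
move=> dn; have n0 : (n + 1)%:R != 0 :> F by rewrite pnatr_eq0 addn1.
rewrite (_ : (n - 2 * d + 1)%:R = (n + 1)%:R - d%:R - d%:R :> F); last first.
  by rewrite -addrA -opprD -natrD -natrB; [congr _%:R; lia | lia].
case: d dn => [|d] dn; rewrite /ballot; first by rewrite !bin0 !subr0 divff ?mul1r.
have Nf (X C N : F) : N != 0 -> N * (X / N * C) = X * C by move=> N0; field.
apply: (mulfI n0); rewrite Nf //.
have -> : 'C(n, d.+1)%:R = 'C(n + 1, d.+1)%:R - 'C(n, d)%:R :> F.
  by rewrite addn1 binS natrD addrK.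
have E : (n + 1)%:R * 'C(n, d)%:R = d.+1%:R * 'C(n + 1, d.+1)%:R :> F.
  by rewrite -!natrM addn1 mul_bin_diag.
transitivity ((n + 1)%:R * 'C(n + 1, d.+1)%:R - (n + 1)%:R * 'C(n, d)%:R
    - (n + 1)%:R * 'C(n, d)%:R : F); first by ring.
by rewrite E; ring.
Qed.

Lemma ballotS n d : ballot n.+1 d.+1 = ballot n d.+1 + ballot n d.
Proof. by case: d => [|d]; rewrite /ballot !binS ?bin0 !natrD; ring. Qed.

(** By the symmetry of binomials no copies lie just beyond the middle; this closes the recursion
    [ballotS] at odd n. *)
Lemma ballot_mid m : ballot m.*2.+1 m.+1 = 0.
Proof.
rewrite /ballot -bin_sub; last by lia.
by rewrite (_ : (m.*2.+1 - m.+1)%N = m) ?subrr //; lia.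
Qed.

(** The branching rule for multiplicities: a block of index d yields one of index d and, unless 2d =
    n, one of index d+1. For odd n both sums on the right stop at the same place up to a term killed
    by [ballot_mid]; for even n the indicator removes the last shifted term. *)
Lemma ballot_sum n (g : nat -> F) :
  \sum_(0 <= d < n./2.+1) ballot n d * (g d + (d + d < n)%N%:R * g d.+1) =
  \sum_(0 <= d < (n.+1)./2.+1) ballot n.+1 d * g d.
Proof.
have -> : \sum_(0 <= d < (n.+1)./2.+1) ballot n.+1 d * g d =
  \sum_(0 <= d < (n.+1)./2.+1) ballot n d * g d +
  \sum_(0 <= d < (n.+1)./2) ballot n d * g d.+1.
  rewrite big_nat_recl // [in RHS]big_nat_recl // -addrA -big_split /=.
  congr (_ + _); first by rewrite /ballot !bin0.
  by apply: eq_bigr => d _; rewrite ballotS mulrDl.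
under eq_bigr => d _ do rewrite mulrDr.
rewrite big_split /=.
case: (boolP (odd n)) => on.
  have nE : n = n./2.*2.+1 by rewrite -[LHS]odd_double_half on.
  have -> : uphalf n = n./2.+1 by lia.
  rewrite [X in _ = X + _]big_nat_recr //=.
  rewrite [X in ballot X n./2.+1]nE ballot_mid mul0r addr0; congr (_ + _); apply: eq_big_nat => d dn.
  by rewrite (_ : (_ < _)%N) ?mul1r //; lia.
have nE : n = n./2.*2 by rewrite -[LHS]odd_double_half (negbTE on).
have -> : uphalf n = n./2 by lia.
congr (_ + _); rewrite big_nat_recr //= ltnNge addnn -nE leqnn mul0r mulr0 addr0.
by apply: eq_big_nat => d dn; rewrite (_ : (_ < _)%N) ?mul1r //; lia.
Qed.

(** [block] is not an equality type here, so validity reaches the summands through [all] rather than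
    through membership. *)
Lemma eq_big_valid T (P : T -> Prop) (V : nmodType) (s : seq T) (f g : T -> V) :
  all (fun b => `[< P b >]) s -> (forall b, P b -> f b = g b) ->
  \sum_(b <- s) f b = \sum_(b <- s) g b.
Proof.
move=> + fg; elim: s => [|b s IH] /=; first by rewrite !big_nil.
by move=> /andP[/asboolP Pb /IH E]; rewrite !big_cons E fg.
Qed.

(** [blocks n] splits the power with n+1 factors; with a single factor the only block is C^2 = Sym^1
    itself. *)
Fixpoint blocks n : seq (block (2 ^ n.+1)) :=
  if n is n'.+1 then flatten (map (@sub_blocks _) (blocks n'))
  else [:: @Block 2 0 1 1%:M 1%:M].

Lemma blocks_valid n : all (fun b => `[< valid_block b >]) (blocks n).
Proof.
elim: n => [|n IH].
  rewrite /= andbT; apply/asboolP; split => //=; first by rewrite mulmx1.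
  by move=> M; rewrite expr0 scale1r mulmx1 mul1mx sympow1.
move: IH => /=; elim: (blocks n) => //= b s IHs /andP[/asboolP vb /IHs vs].
by rewrite all_cat vs andbT; exact: sub_blocks_valid.
Qed.

Lemma blocks_proj n : \sum_(b <- blocks n) block_proj b = 1%:M.
Proof.
elim: n => [|n IH]; first by rewrite big_seq1 /block_proj /= mulmx1.
rewrite /= big_flatten big_map /=.
under eq_bigr => b _ do rewrite sub_blocks_proj.
rewrite -[RHS](tensmx11 2 (2 ^ n.+1)) -IH; apply/matrixP => i j.
rewrite summxE !mxE summxE mulr_sumr.
by apply: eq_bigr => b _; rewrite ?mxE.
Qed.

Lemma blocks_sum n (g : nat -> F) :
  \sum_(b <- blocks n) g (block_deg b) =
  \sum_(0 <= d < (n.+1)./2.+1) ballot n.+1 d * g d.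
Proof.
elim: n g => [|n IH] g.
  by rewrite big_seq1 /= big_nat1 /ballot bin0 subr0 mul1r.
rewrite /= big_flatten big_map /=.
under eq_bigr => b _ do rewrite sub_blocks_sum.
apply: etrans (ballot_sum n.+1 g).
rewrite -(IH (fun d => g d + (d + d < n.+1)%N%:R * g d.+1)).
apply: (eq_big_valid (blocks_valid n)) => b [nE _ _].
case: b nE => d k U T /= nE.
by rewrite (_ : (0 < k)%N = (d + d < n.+1)%N) //; lia.
Qed.

End Blocks.

(** * Relative entropy from the eigenvalues on the blocks *)

Section PolynomialCalculus.
Variable F : fieldType.

Definition polymx n (p : {poly F}) (A : 'M[F]_n) : 'M[F]_n :=
  \sum_(i < size p) p`_i *: A ^+ i.

Lemma polymx_intertwines n k p (A : 'M[F]_n) (B : 'M[F]_k) (U : 'M[F]_(n, k)) :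
  A *m U = U *m B -> polymx p A *m U = U *m polymx p B.
Proof.
move=> AU; have AUi i : A ^+ i *m U = U *m B ^+ i.
  elim: i => [|i IH]; first by rewrite !expr0 mul1mx mulmx1.
  by rewrite !exprSr -mulmxA AU mulmxA IH -mulmxA.
rewrite /polymx mulmx_suml mulmx_sumr; apply: eq_bigr => i _.
by rewrite -scalemxAl -scalemxAr AUi.
Qed.

Lemma polymx_diag n p (D : 'rV[F]_n) :
  polymx p (diag_mx D) = diag_mx (map_mx (horner p) D).
Proof.
have Di i : diag_mx D ^+ i = diag_mx (map_mx (fun x => x ^+ i) D).
  elim: i => [|i IH].
    by rewrite expr0; apply/matrixP => a b; rewrite !mxE.
  rewrite exprS IH [LHS]mulmx_diag; congr diag_mx.
  by apply/rowP => j; rewrite !mxE exprS.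
apply/matrixP => a b; rewrite summxE !mxE horner_coef.
under eq_bigr => i _ do rewrite Di !mxE.
case: eqP => _; last by rewrite big1 ?mulr0n // => i _; rewrite mulr0n mulr0.
by rewrite mulr1n; apply: eq_bigr => i _; rewrite mulr1n.
Qed.

Lemma polymx_scalar n p (c : F) : polymx p (c%:M : 'M[F]_n) = (p.[c])%:M.
Proof.
rewrite -!diag_const_mx polymx_diag; congr diag_mx.
by apply/rowP => j; rewrite !mxE.
Qed.

Lemma polymx_trace_mul n p (A : 'M[F]_n) :
  \tr (A *m polymx p A) = \sum_(i < size p) p`_i * \tr (A ^+ i.+1).
Proof.
rewrite /polymx mulmx_sumr raddf_sum; apply: eq_bigr => i _ /=.
by rewrite -scalemxAr mxtraceZ exprS.
Qed.

Lemma interpolation (s : seq F) (f : F -> F) :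
  exists p : {poly F}, {in s, forall x, p.[x] = f x}.
Proof.
elim: s => [|y s [p ps]]; first by exists 0.
have [ys|ys] := boolP (y \in s).
  by exists p => x; rewrite inE => /predU1P[->|]; exact: ps.
(* Newton's step: [q] vanishes at the old nodes and not at [y], so a multiple of it corrects the
   value at [y] alone. *)
pose q := \prod_(x <- s) ('X - x%:P).
have qy : q.[y] != 0 by rewrite -[_ == 0]/(root q y) root_prod_XsubC.
exists (p + ((f y - p.[y]) / q.[y]) *: q) => x; rewrite inE hornerD hornerZ.
case: eqP => [-> _ | _ /= xs]; first by rewrite divfK // addrC subrK.
have /rootP -> : root q x by rewrite root_prod_XsubC.
by rewrite mulr0 addr0 ps.
Qed.

End PolynomialCalculus.

Section TensorPower.
Variable F : numFieldType.
Implicit Types M N : 'M[F]_2.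

Lemma mxtrace_ntensmx M n : \tr (ntensmx M n.+1) = (\tr M) ^+ n.+1.
Proof.
elim: n => [|n IH]; first by rewrite ntensmx1 expr1.
by rewrite ntensmxSS mxtrace_tensmx IH [RHS]exprS.
Qed.

Lemma ntensmx_mul M N n :
  ntensmx (M *m N) n.+1 = ntensmx M n.+1 *m ntensmx N n.+1.
Proof.
elim: n => [|n IH]; first by rewrite !ntensmx1.
by rewrite !ntensmxSS [RHS]tensmx_mul IH.
Qed.

Lemma ntensmx_exp M n i : ntensmx M n.+1 ^+ i.+1 = ntensmx (M ^+ i.+1) n.+1.
Proof.
elim: i => [|i IH]; first by rewrite !expr1.
by rewrite exprS IH [in RHS]exprS [RHS]ntensmx_mul.
Qed.

(** Cayley-Hamilton in size 2, the source of the recurrence for power traces. *)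
Lemma sqr_mx2 M : M ^+ 2 = \tr M *: M - (\det M)%:M.
Proof.
rewrite expr2 det_mx2E /mxtrace big_ord_recl big_ord1.
rewrite (_ : lift ord0 ord0 = 1); last exact: val_inj.
apply/matrixP => i j; rewrite !mxE big_ord_recl big_ord1 /=.
rewrite (_ : lift ord0 ord0 = 1); last exact: val_inj.
case: (ord2P i) => ->; case: (ord2P j) => -> /=; rewrite ?mulr1n ?mulr0n; ring.
Qed.

Lemma mxtrace_exp2 M a b i : \tr M = a + b -> \det M = a * b ->
  \tr (M ^+ i) = a ^+ i + b ^+ i.
Proof.
move=> trM detM.
have [] : \tr (M ^+ i) = a ^+ i + b ^+ i /\ \tr (M ^+ i.+1) = a ^+ i.+1 + b ^+ i.+1;
  last by [].
elim: i => [|i [IH0 IH1]]; first by rewrite !expr0 !expr1 mxtrace1.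
split=> //.
have -> : M ^+ i.+2 = M ^+ i *m (\tr M *: M - (\det M)%:M).
  by rewrite -sqr_mx2 -[RHS]exprD addn2.
rewrite mulmxBr raddfB /= -scalemxAr mxtraceZ mul_mx_scalar mxtraceZ.
rewrite (_ : M ^+ i *m M = M ^+ i.+1) ?[RHS]exprSr // IH0 IH1 trM detM.
by rewrite !exprS; ring.
Qed.

(** The spectrum of the tensor power, with multiplicities, is read off from Tr (M^i)^(n+1) = (a^i +
    b^i)^(n+1) by the binomial theorem. *)
Lemma mxtrace_ntensmx_poly M a b n p : \tr M = a + b -> \det M = a * b ->
  \tr (ntensmx M n.+1 *m polymx p (ntensmx M n.+1)) =
  \sum_(j < n.+2) 'C(n.+1, j)%:R * (a ^+ (n.+1 - j) * b ^+ j) *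
     p.[a ^+ (n.+1 - j) * b ^+ j].
Proof.
move=> trM detM; rewrite polymx_trace_mul.
under eq_bigr => i _ do
  rewrite ntensmx_exp mxtrace_ntensmx (mxtrace_exp2 _ trM detM) exprDn mulr_sumr.
rewrite exchange_big; apply: eq_bigr => j _ /=.
rewrite horner_coef mulr_sumr; apply: eq_bigr => i _.
have -> : (a ^+ i.+1) ^+ (n.+1 - j) * (b ^+ i.+1) ^+ j =
    (a ^+ (n.+1 - j) * b ^+ j) ^+ i.+1.
  by rewrite exprMn -!exprM ![(i.+1 * _)%N]mulnC.
by rewrite -[_ *+ 'C(_, _)]mulr_natl exprS; ring.
Qed.

End TensorPower.

Section Logarithm.
Local Open Scope complex_scope.
Variable R : realType.
Local Notation C := R[i].

Definition lnC (a : C) : C := (ln (complex.Re a))%:C.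

(** The nodes are the entries of [spectral_diag A], which determine [log_mx A], together with the
    values [s] at which the trace formulas will evaluate [p]. The latter therefore never have to be
    identified with spectral entries. *)
Lemma log_mx_poly m (A : 'M[C]_m) (s : seq C) : A \is hermsymmx ->
  exists2 p, log_mx A = polymx p A & {in s, forall x, p.[x] = lnC x}.
Proof.
move=> /hermitian_normalmx /orthomx_spectralP AE.
have [p pE] := interpolation (s ++ [seq spectral_diag A 0 i | i <- enum 'I_m]) lnC.
exists p; last by move=> x xs; apply: pE; rewrite mem_cat xs.
have Pu := spectral_unit A.
rewrite /log_mx.
have -> : map_mx (fun a : C => (ln (complex.Re a))%:C) (spectral_diag A) =
    map_mx (horner p) (spectral_diag A).
  apply/rowP => i; rewrite !mxE -/(lnC _) pE // mem_cat; apply/orP; right.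
  by apply/mapP; exists i; rewrite ?mem_enum.
rewrite -polymx_diag -(@polymx_intertwines _ _ _ _ A) ?mulmxKV //.
by rewrite {1}AE mulmxK.
Qed.

End Logarithm.

Section BinomialEntropy.
Variable R : realType.

Lemma binomial_mean (a b : R) n :
  \sum_(j < n.+2) 'C(n.+1, j)%:R * (a ^+ (n.+1 - j) * b ^+ j) * j%:R =
  n.+1%:R * b * (a + b) ^+ n.
Proof.
rewrite big_ord_recl mulr0 add0r exprDn mulr_sumr; apply: eq_bigr => i _.
rewrite lift0 subSS [b ^+ _.+1]exprS -(mulr_natl (a ^+ _ * _)).
have E : 'C(n.+1, i.+1)%:R * i.+1%:R = n.+1%:R * 'C(n, i)%:R :> R.
  by rewrite -!natrM mulnC -mul_bin_diag.
transitivity ('C(n.+1, i.+1)%:R * i.+1%:R * (a ^+ (n - i) * (b * b ^+ i))).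
  by ring.
by rewrite E; ring.
Qed.

Lemma ln_expr (x : R) n : 0 < x -> ln (x ^+ n) = n%:R * ln x.
Proof. by move=> x0; rewrite lnXn // mulr_natl. Qed.

(** The logarithm of a^(n+1-j) b^j is affine in j, so only the mass and the mean of the binomial law
    enter. *)
Lemma binomial_entropy (a b : R) n : 0 < a -> 0 <= b -> a + b = 1 ->
  \sum_(j < n.+2) 'C(n.+1, j)%:R * (a ^+ (n.+1 - j) * b ^+ j) *
     ln (a ^+ (n.+1 - j) * b ^+ j) =
  n.+1%:R * (a * ln a + b * ln b).
Proof.
move=> a0 b0 ab.
have sum1 : \sum_(j < n.+2) 'C(n.+1, j)%:R * (a ^+ (n.+1 - j) * b ^+ j) = 1.
  transitivity ((a + b) ^+ n.+1); last by rewrite ab expr1n.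
  by rewrite exprDn; apply: eq_bigr => i _; rewrite mulr_natl.
have mean := binomial_mean a b n; rewrite ab expr1n mulr1 in mean.
transitivity (\sum_(j < n.+2) ('C(n.+1, j)%:R * (a ^+ (n.+1 - j) * b ^+ j) *
     (n.+1%:R * ln a) + 'C(n.+1, j)%:R * (a ^+ (n.+1 - j) * b ^+ j) * j%:R
        * (ln b - ln a))).
  apply: eq_bigr => -[j jn] _ /=; have jn' : (j <= n.+1)%N by [].
  (* Here the logarithm of the product does not split, but the weight vanishes for j > 0 and b does
     not occur for j = 0. *)
  have [b00|b00] := eqVneq b 0.
    case: j jn jn' => [|j] jn jn'.
      by rewrite b00 expr0 mulr1 ln_expr // mulr0 mul0r addr0.
    by rewrite b00 exprS; ring.
  have bp : 0 < b by rewrite lt_neqAle eq_sym b00.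
  rewrite lnM ?posrE ?exprn_gt0 // !ln_expr // natrB //; ring.
rewrite big_split /= -!mulr_suml sum1 mean.
have -> : a = 1 - b by lra.
by ring.
Qed.

End BinomialEntropy.

Section RelativeEntropy.
Local Open Scope complex_scope.
Variable R : realType.
Local Notation C := R[i].

Lemma hermsymmxP m (A : 'M[C]_m) :
  (forall i j, A i j = (A j i)^*) -> A \is hermsymmx.
Proof.
move=> AE; apply/is_hermitianmxP; rewrite expr0 scale1r.
by apply/matrixP => i j; rewrite !mxE AE.
Qed.

Lemma ntensmx_conj (A : 'M[C]_2) n : (forall i j, A i j = (A j i)^*) ->
  forall i j, ntensmx A n.+1 i j = (ntensmx A n.+1 j i)^*.
Proof.
move=> HA; elim: n => [|n IH]; first by rewrite ntensmx1.
move=> i j; rewrite ntensmxSS !mxE [RHS]rmorphM; congr (_ * _); first exact: HA.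
exact: IH.
Qed.

Lemma relative_entropy_ntens n (rho : 'M[C]_2) (Z : 'M[C]_(2 ^ n.+1)) (a b : R)
    (lam : nat -> R) :
  (forall i j, rho i j = (rho j i)^*) -> \tr rho = a%:C + b%:C ->
  \det rho = a%:C * b%:C ->
  0 < a -> 0 <= b -> a + b = 1 ->
  Z \is hermsymmx ->
  (forall d, (d + d <= n.+1)%N -> 0 < lam d) ->
  (forall c : block C (2 ^ n.+1), valid_block c ->
     Z *m block_in c = (lam (block_deg c))%:C *: block_in c) ->
  relative_entropy (ntensmx rho n.+1) Z =
  (n.+1%:R * (a * ln a + b * ln b) -
   \sum_(0 <= d < (n.+1)./2.+1) ballot R n.+1 d *
     ((a * b) ^+ d * \sum_(i < (n.+1 - d - d).+1) a ^+ (n.+1 - d - d - i) * b ^+ i) *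
     ln (lam d))%:E.
Proof.
move=> rhoH trE detE a0 b0 ab HZ lam0 Zblock.
set A := ntensmx rho n.+1.
have HA : A \is hermsymmx by apply: hermsymmxP; exact: ntensmx_conj.
have polyZ p (c : block C (2 ^ n.+1)) : valid_block c ->
    polymx p Z *m block_in c = p.[(lam (block_deg c))%:C] *: block_in c.
  move=> vc; rewrite (@polymx_intertwines _ _ _ p Z (lam (block_deg c))%:C%:M).
    by rewrite polymx_scalar mul_mx_scalar.
  by rewrite mul_mx_scalar Zblock.
have polyZE p : polymx p Z =
    \sum_(c <- blocks C n) p.[(lam (block_deg c))%:C] *: block_proj c.
  rewrite -[LHS]mulmx1 -blocks_proj mulmx_sumr.
  apply: (eq_big_valid (blocks_valid C n)) => c vc.
  by rewrite mulmxA polyZ // -scalemxAl.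
(* Inverting the eigenvalue on each block gives a right inverse. So the kernel of [Z] is trivial and
   the value [+oo] is excluded, even when [rho] is singular. *)
have unitZ : Z \in unitmx.
  have : Z *m (\sum_(c <- blocks C n) (lam (block_deg c))%:C^-1 *: block_proj c) = 1%:M.
    rewrite -blocks_proj mulmx_sumr.
    apply: (eq_big_valid (blocks_valid C n)) => c vc.
    rewrite -scalemxAr mulmxA Zblock // -scalemxAl scalerA mulVf ?scale1r //.
    rewrite fmorph_eq0 gt_eqF // lam0 //; case: vc => nE _ _.
    by case: c nE => d k U T /= ->; rewrite leq_addr.
  by move=> /mulmx1_unit[].
rewrite /relative_entropy (_ : kermx Z = 0); last first.
  by apply/eqP; rewrite kermx_eq0 row_free_unit.
rewrite sub0mx; congr EFin.
(* The full complex trace is shown to be a real number; the real part is then immediate. *)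
suff -> : \tr (A *m (log_mx A - log_mx Z)) =
  (n.+1%:R * (a * ln a + b * ln b) -
   \sum_(0 <= d < (n.+1)./2.+1) ballot R n.+1 d *
     ((a * b) ^+ d * \sum_(i < (n.+1 - d - d).+1) a ^+ (n.+1 - d - d - i) * b ^+ i) *
     ln (lam d))%:C by [].
rewrite mulmxBr raddfB /= rmorphB; congr (_ - _).
  have [p -> pE] := log_mx_poly
    [seq a%:C ^+ (n.+1 - j) * b%:C ^+ j | j <- iota 0 n.+2] HA.
  rewrite (mxtrace_ntensmx_poly _ _ trE detE) -binomial_entropy // rmorph_sum.
  apply: eq_bigr => j _; rewrite pE; last first.
    by apply/mapP; exists (j : nat) => //; rewrite mem_iota /= add0n.
  by rewrite /lnC -!rmorphXn -rmorphM /= -[in LHS](rmorph_nat (real_complex R)) -!rmorphM.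
have [p -> pE] := log_mx_poly
  [seq (lam d)%:C | d <- iota 0 (n.+1)./2.+1] HZ.
rewrite polyZE mulmx_sumr raddf_sum /=.
pose g d : C := (((a * b) ^+ d *
  \sum_(i < (n.+1 - d - d).+1) a ^+ (n.+1 - d - d - i) * b ^+ i) * ln (lam d))%:C.
transitivity (\sum_(c <- blocks C n) g (block_deg c)).
  apply: (eq_big_valid (blocks_valid C n)) => c [nE TU HU].
  rewrite pE; last first.
    apply/mapP; exists (block_deg c) => //; rewrite mem_iota /= add0n.
    by case: c nE {TU HU} => d k U T /= nE; lia.
  (* Cyclicity brings [block_out] next to [block_in], which leaves the trace of det^d Sym^k. *)
  rewrite /block_proj -scalemxAr mxtraceZ mulmxA HU -scalemxAl mxtraceZ.
  rewrite -mulmxA mxtrace_mulC -mulmxA TU mulmx1.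
  rewrite (mxtrace_sympow _ trE detE) detE.
  have -> : block_ord c = (n.+1 - block_deg c - block_deg c)%N.
    by case: c nE {TU HU} => d k U T /= nE; lia.
  have trC : (a%:C * b%:C) ^+ block_deg c * (\sum_(i < (n.+1 - block_deg c - block_deg c).+1)
      a%:C ^+ (n.+1 - block_deg c - block_deg c - i) * b%:C ^+ i) =
    ((a * b) ^+ block_deg c * \sum_(i < (n.+1 - block_deg c - block_deg c).+1)
       a ^+ (n.+1 - block_deg c - block_deg c - i) * b ^+ i)%:C.
    rewrite rmorphM rmorphXn rmorphM rmorph_sum /=.
    by under [in RHS]eq_bigr => i _ do rewrite rmorphM !rmorphXn.
  by rewrite trC /g /lnC /= mulrC [RHS]rmorphM.
rewrite blocks_sum rmorph_sum; apply: eq_bigr => d _ /=.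
have -> : ballot C n.+1 d = (ballot R n.+1 d)%:C.
  by case: d => [|d]; rewrite /ballot rmorphB ?rmorph0 !rmorph_nat.
by rewrite /g -[in RHS]mulrA [RHS]rmorphM.
Qed.

End RelativeEntropy.

(** * The Gamma function and Dirichlet integrals over the ball *)

Section ChangeOfVariable.
Variable R : realType.
Local Notation mu := (@lebesgue_measure R).
Implicit Type f : R -> \bar R.
Local Open Scope ereal_scope.

Lemma measurable_affine (c e : R) :
  measurable_fun setT (fun x : measurableTypeR R => (c * x + e)%R : measurableTypeR R).
Proof. by apply: measurable_funD => //; apply: measurable_funM. Qed.

(** The image of Lebesgue measure under x -> c x + e, scaled by c, gives half-open intervals their
    length, hence is Lebesgue measure by uniqueness. *)
Lemma ge0_integral_affine f (c e : R) : (0 < c)%R ->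
  measurable_fun setT f -> (forall x, 0 <= f x) ->
  \int[mu]_x f x = c%:E * \int[mu]_x f (c * x + e)%R.
Proof.
move=> c0 mf f0.
pose phi (x : measurableTypeR R) : measurableTypeR R := (c * x + e)%R.
have mphi : measurable_fun setT phi := measurable_affine c e.
pose cn : {nonneg R} := NngNum (ltW c0).
pose nu := measure_function_pushforward__canonical__measure_function_Measure mu mphi.
transitivity (\int[mscale cn nu]_x f x).
  apply: eq_measure_integral => A mA _; apply: lebesgue_measure_unique => //.
  move=> _ [[a b] _ <-] /=.
  rewrite /mscale /= /pushforward.
  have -> : phi @^-1` `]a, b]%classic = `](a - e) / c, (b - e) / c]%classic%R.
    apply/seteqP; split => x /=; rewrite !in_itv /= /phi;
      by rewrite ltr_pdivrMr // ler_pdivlMr // ltrBlDr lerBrDr mulrC.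
  rewrite !lebesgue_measure_itv /= !lte_fin ltr_pM2r ?invr_gt0 // ltrD2r.
  case: ifP => _; last by rewrite mule0.
  rewrite -!EFinD -EFinM; congr EFin.
  by rewrite -mulrBl mulrC divfK ?gt_eqF //; ring.
rewrite ge0_integral_mscale //=; congr (_ * _).
by rewrite ge0_integral_pushforward.
Qed.

Lemma ge0_integral_opp f :
  measurable_fun setT f -> (forall x, 0 <= f x) ->
  \int[mu]_x f x = \int[mu]_x f (- x)%R.
Proof.
move=> mf f0.
have mN : measurable_fun setT (-%R : measurableTypeR R -> measurableTypeR R) by [].
pose nu := measure_function_pushforward__canonical__measure_function_Measure mu mN.
transitivity (\int[nu]_x f x).
  by apply: eq_measure_integral => A mA _; rewrite -[LHS](@lebesgue_measureN R).
by rewrite ge0_integral_pushforward.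
Qed.

Lemma ge0_integralZlR (k : R) (h : R -> R) : (0 <= k)%R ->
  measurable_fun setT h -> (forall x, (0 <= h x)%R) ->
  \int[mu]_x (k * h x)%:E = k%:E * \int[mu]_x (h x)%:E.
Proof.
move=> k0 mh h0; under eq_integral => x _ do rewrite EFinM.
rewrite ge0_integralZl_EFin //; last exact/measurable_EFinP.
by move=> x _; rewrite lee_fin.
Qed.

Lemma ge0_integral_swap (f : R -> R -> R) :
  measurable_fun setT
    (fun p : measurableTypeR R * measurableTypeR R => f p.1 p.2) ->
  (forall x y, (0 <= f x y)%R) ->
  \int[mu]_x \int[mu]_y (f x y)%:E = \int[mu]_y \int[mu]_x (f x y)%:E.
Proof.
move=> mf f0; pose g (p : measurableTypeR R * measurableTypeR R) := (f p.1 p.2)%:E.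
have mg : measurable_fun setT g by exact/measurable_EFinP.
have g0 p : 0 <= g p by rewrite lee_fin.
exact: (fubini_tonelli (m1 := mu) (m2 := mu) g mg g0).
Qed.

End ChangeOfVariable.

Section GammaTerms.
Variable R : realType.
Local Notation mu := (@lebesgue_measure R).

(** The cut-off is explicit because [powR] does not vanish at negative bases; all integrals can then
    run over the whole line. *)
Definition pos_pow (p t : R) : R := if 0 < t then t `^ p else 0.

Lemma pos_pow_ge0 p t : 0 <= pos_pow p t.
Proof. by rewrite /pos_pow; case: ifP => // _; exact: powR_ge0. Qed.

Lemma pos_powE p t : 0 < t -> pos_pow p t = t `^ p.
Proof. by rewrite /pos_pow => ->. Qed.

Lemma measurable_pos_pow p : measurable_fun setT (pos_pow p).
Proof.
by apply: measurable_fun_ifT => //=; exact: measurable_fun_ltr.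
Qed.

(** Extended-valued, so that Tonelli identities can be stated before finiteness is known. *)
Definition eGamma (s : R) : \bar R :=
  (\int[mu]_t (pos_pow (s - 1) t * expR (- t))%:E)%E.

Definition even_gauss (a : nat) : \bar R :=
  (\int[mu]_x (x ^+ (a + a) * expR (- x ^+ 2))%:E)%E.

Lemma expr_even_ge0 (x : R) a : 0 <= x ^+ (a + a).
Proof. by rewrite exprD -expr2 sqr_ge0. Qed.

End GammaTerms.

Section Slice.
Variable R : realType.
Local Notation mu := (@lebesgue_measure R).
Variables (K : R -> R) (s : R) (a : nat).
Hypothesis mK : measurable_fun setT K.
Hypothesis K0 : forall t, 0 <= K t.
Hypothesis KN1 : K (- 1) = 0.
Hypothesis Khom : forall t w, 0 < t -> K (t * w) = t `^ (- s) * K w.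

(** Integrates out one coordinate of the ball, t being what the other coordinates leave of 1.
    Homogeneity of [K] makes the result a power of t again, so the operation can be iterated. *)
Definition slice (t : R) : \bar R :=
  (\int[mu]_x (x ^+ (a + a) * K (t - x ^+ 2))%:E)%E.

Lemma kernel_lt0 w : w < 0 -> K w = 0.
Proof.
by move=> w0; rewrite -[w]opprK -mulrN1 Khom ?oppr_gt0 // KN1 mulr0.
Qed.

Lemma measurable_slice (t : R) : measurable_fun setT (fun x : R => x ^+ (a + a) * K (t - x ^+ 2)).
Proof.
apply: measurable_funM => //; apply: measurableT_comp => //.
by apply: measurable_funB => //.
Qed.

(** Rescaling x by sqrt t: the exponent receives a from x^(2a), 1/2 from dx and -s from the
    kernel. *)
Lemma slice_pos t : 0 < t ->
  slice t = ((t `^ (a%:R + 2^-1 - s))%:E * slice 1)%E.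
Proof.
move=> t0; rewrite /slice.
have st : 0 < Num.sqrt t by rewrite sqrtr_gt0.
have ge0 t' x : 0 <= x ^+ (a + a) * K (t' - x ^+ 2).
  by rewrite mulr_ge0 ?expr_even_ge0.
rewrite (ge0_integral_affine 0 st); last 2 first.
- by apply/measurable_EFinP; exact: measurable_slice.
- by move=> x; rewrite lee_fin.
rewrite -[LHS](ge0_integralZlR (ltW st)) //; last first.
  apply: (measurableT_comp (measurable_slice t)); exact: measurable_affine.
rewrite -(ge0_integralZlR (powR_ge0 _ _) (measurable_slice 1)) //.
apply: eq_integral => x _; congr EFin.
rewrite addr0 exprMn [(_ * x) ^+ 2]exprMn sqr_sqrtr ?ltW //.
rewrite (_ : t - t * x ^+ 2 = t * (1 - x ^+ 2)); last by rewrite mulrBr mulr1.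
rewrite Khom //.
have -> : Num.sqrt t ^+ (a + a) = t ^+ a.
  by rewrite addnn -mul2n exprM sqr_sqrtr ?ltW.
rewrite powRD; last by rewrite (gt_eqF t0) implybT.
rewrite powRD; last by rewrite (gt_eqF t0) implybT.
by rewrite powR_mulrn ?ltW // powR12_sqrt ?ltW //; ring.
Qed.

Lemma slice_nonpos t : t <= 0 -> slice t = 0%E.
Proof.
move=> t0; rewrite /slice.
(* Off x = 0 the kernel has a negative argument. At t = 0 the point x = 0 may give a nonzero value,
   but it is negligible. *)
transitivity (\int[mu]_(x in [set (0%R : R)]) (x ^+ (a + a) * K (t - x ^+ 2))%:E)%E.
  rewrite [RHS]integral_mkcond; apply: eq_integral => x _.
  rewrite patchE; case: ifPn => // /negP x0.
  rewrite kernel_lt0 ?mulr0 // subr_lt0 (le_lt_trans t0) // exprn_even_gt0 //=.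
  by apply/eqP => x00; apply: x0; rewrite inE.
exact: integral_set1.
Qed.

(** The Laplace transform of [K] at 1. *)
Definition kernel_gamma : \bar R := (\int[mu]_w (expR (- w) * K w)%:E)%E.

(* Tonelli for the integrand [x^(2a) e^(-t) K (t - x^2)] in [x] and [t]. *)
Lemma slice_gamma :
  (slice 1 * eGamma (a%:R + 2^-1 - s + 1) = kernel_gamma * even_gauss R a)%E.
Proof.
pose f (x t : R) : R := x ^+ (a + a) * (expR (- t) * K (t - x ^+ 2)).
have f0 x t : 0 <= f x t.
  by rewrite mulr_ge0 ?expr_even_ge0 // mulr_ge0 ?expR_ge0.
have := ge0_integral_swap (f := f) _ f0.
have mKe : measurable_fun setT (fun w : R => expR (- w) * K w).
  by apply: measurable_funM => //; apply: measurableT_comp => //.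
have mg : measurable_fun setT (fun x : R => x ^+ (a + a) * expR (- x ^+ 2)).
  apply: measurable_funM => //; apply: measurableT_comp => //.
  by apply: measurableT_comp => //.
have Ke0 w : 0 <= expR (- w) * K w by rewrite mulr_ge0 ?expR_ge0.
have kg0 : (0 <= kernel_gamma)%E.
  by apply: integral_ge0 => x _; rewrite lee_fin.
have J0 : (0 <= slice 1)%E.
  by apply: integral_ge0 => x _; rewrite lee_fin mulr_ge0 ?expr_even_ge0.
have -> : (\int[mu]_x \int[mu]_t (f x t)%:E = kernel_gamma * even_gauss R a)%E.
  transitivity (\int[mu]_x (kernel_gamma *
       (x ^+ (a + a) * expR (- x ^+ 2))%:E))%E; last first.
    rewrite ge0_integralZl //; first exact/measurable_EFinP.
    by move=> x _; rewrite lee_fin mulr_ge0 ?expr_even_ge0 ?expR_ge0.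
  apply: eq_integral => x _; rewrite muleC.
  rewrite -ge0_integralZlR ?mulr_ge0 ?expr_even_ge0 ?expR_ge0 //.
  rewrite (ge0_integral_affine (x ^+ 2) (@ltr01 R)); last 2 first.
  - apply/measurable_EFinP; apply: measurable_funM => //; apply: measurable_funM.
      by apply: measurableT_comp => //.
    by apply: measurableT_comp => //; apply: measurable_funB => //.
  - by move=> t; rewrite lee_fin.
  rewrite mul1e; apply: eq_integral => t _; rewrite /f mul1r addrK opprD expRD.
  by congr EFin; ring.
have -> : (\int[mu]_t \int[mu]_x (f x t)%:E =
    slice 1 * eGamma (a%:R + 2^-1 - s + 1))%E.
  transitivity (\int[mu]_t (slice 1 *
       (pos_pow (a%:R + 2^-1 - s) t * expR (- t))%:E))%E; last first.
    rewrite /eGamma addrK; apply: ge0_integralZl => //.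
      apply/measurable_EFinP; apply: measurable_funM; first exact: measurable_pos_pow.
      exact: measurableT_comp.
    by move=> x _; rewrite lee_fin; exact: mulr_ge0 (pos_pow_ge0 _ _) (expR_ge0 _).
  apply: eq_integral => t _.
  transitivity ((expR (- t))%:E * slice t)%E.
    rewrite -ge0_integralZlR ?expR_ge0 //; last first.
    - by move=> x; rewrite mulr_ge0 ?expr_even_ge0.
    - exact: measurable_slice.
    by apply: eq_integral => x _; congr EFin; rewrite /f; ring.
  have [t0|t0] := ltP 0 t.
    by rewrite slice_pos // pos_powE // EFinM muleCA [RHS]muleCA (muleC (slice 1)).
  by rewrite slice_nonpos // /pos_pow ltNge t0 /= mul0r !mule0.
move=> -> //; apply: measurable_funM; first by apply: measurable_funX.
apply: measurable_funM; first by apply: measurableT_comp => //; exact: measurableT_comp.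
apply: measurableT_comp => //; apply: measurable_funB => //.
by apply: measurable_funX.
Qed.

End Slice.

Section Kernels.
Variable R : realType.
Local Notation mu := (@lebesgue_measure R).

(** Written as in [prior_density], and kept at w = 0 because the ball is closed. It can differ from
    [pos_pow (- s)] at 0 only; the latter is the form in which a slice reproduces the kernel, which
    is why both are treated. *)
Definition ball_kernel (s w : R) : R := if 0 <= w then (w `^ s)^-1 else 0.

Lemma ball_kernel_ge0 s w : 0 <= ball_kernel s w.
Proof. by rewrite /ball_kernel; case: ifP => // _; rewrite invr_ge0 powR_ge0. Qed.

Lemma ball_kernelN1 s : ball_kernel s (-1) = 0.
Proof. by rewrite /ball_kernel lerNr oppr0 ler10. Qed.

Lemma ball_kernel_hom s t w : 0 < t ->
  ball_kernel s (t * w) = t `^ (- s) * ball_kernel s w.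
Proof.
move=> t0; rewrite /ball_kernel pmulr_rge0 //; case: ifP => w0; last by rewrite mulr0.
by rewrite (powRM _ (ltW t0) w0) invfM powRN.
Qed.

Lemma measurable_ball_kernel s : measurable_fun setT (ball_kernel s).
Proof.
rewrite (_ : ball_kernel s = fun w => if 0 <= w then w `^ (- s) else 0); last first.
  by apply/funext => w; rewrite /ball_kernel powRN.
by apply: measurable_fun_ifT => //=; exact: measurable_fun_ler.
Qed.

Lemma pos_powN1 p : pos_pow p (-1) = 0 :> R.
Proof. by rewrite /pos_pow ltrNr oppr0 ltr10. Qed.

Lemma pos_pow_hom s (t w : R) : 0 < t ->
  pos_pow (- s) (t * w) = t `^ (- s) * pos_pow (- s) w.
Proof.
move=> t0; rewrite /pos_pow pmulr_rgt0 //; case: ifP => w0; last by rewrite mulr0.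
by rewrite (powRM _ (ltW t0) (ltW w0)).
Qed.

(** A point is negligible, so conventions for powers at 0 do not affect the integrals. *)
Lemma integral_neq0 (f g : R -> R) : measurable_fun setT f -> measurable_fun setT g ->
  (forall x, x != 0 -> f x = g x) ->
  (\int[mu]_x (f x)%:E = \int[mu]_x (g x)%:E)%E.
Proof.
move=> mf mg fg.
have mT : measurable ([set: R] `\ 0) by apply: measurableD.
rewrite -(@integral_setD1 _ _ 0 setT) //; last first.
  by apply/measurable_EFinP; exact: measurable_funTS.
rewrite -(@integral_setD1 _ (fun x => (g x)%:E) 0 setT) //; last first.
  by apply/measurable_EFinP; exact: measurable_funTS.
apply: eq_integral => x; rewrite inE => -[_ /= x0].
by rewrite fg //; apply/eqP.
Qed.

Lemma kernel_gamma_ball s : kernel_gamma (ball_kernel s) = eGamma (1 - s).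
Proof.
apply: integral_neq0.
- apply: measurable_funM; first exact: measurableT_comp.
  exact: measurable_ball_kernel.
- apply: measurable_funM; last exact: measurableT_comp.
  exact: measurable_pos_pow.
- move=> x x0; rewrite mulrC; congr (_ * _).
  by rewrite /ball_kernel /pos_pow le_eqVlt eq_sym (negbTE x0) addrAC subrr add0r powRN.
Qed.

Lemma kernel_gamma_pos s : kernel_gamma (pos_pow (- s)) = eGamma (1 - s) :> \bar R.
Proof.
by apply: eq_integral => x _; rewrite mulrC addrAC subrr add0r.
Qed.

(** The exponential law of rate 1 has mass 1. *)
Lemma eGamma1 : eGamma 1 = 1%E :> \bar R.
Proof.
rewrite -(@integral_exponential_pdf R 1) //.
apply: integral_neq0.
- apply: measurable_funM; last exact: measurableT_comp.
  exact: measurable_pos_pow.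
- exact: measurable_exponential_pdf.
- move=> x x0; rewrite /pos_pow; case: ltP => xp.
    rewrite exponential_pdfE ?ltW //= subrr powRr0 !mul1r.
    by rewrite mulN1r.
  by rewrite lt0_exponential_pdf ?mul0r // lt_neqAle x0.
Qed.

(** For s < 1 the integrand is unbounded at 0, so the fundamental theorem is applied on [1/(i+1), 1]
    and the limit is taken by monotone convergence. *)
Lemma integral_powR01 (s : R) : 0 < s ->
  (\int[mu]_(x in `]0%R, 1%R]) (x `^ (s - 1))%:E = (s^-1)%:E)%E.
Proof.
move=> s0.
pose F (i : nat) : set R := `[(i.+1%:R^-1 : R), 1%R]%classic.
have FU : \bigcup_i F i = `]0%R, 1%R]%classic.
  apply/seteqP; split => x /=.
    move=> [i _]; rewrite /F /= !in_itv /= => /andP[ix ->]; rewrite andbT.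
    by rewrite (lt_le_trans _ ix) // invr_gt0.
  rewrite in_itv /= => /andP[x0 x1]; exists (Num.truncn x^-1) => //.
  rewrite /F /= in_itv /= x1 andbT -[x]invrK lef_pV2 ?posrE ?invr_gt0 //.
  by rewrite invrK ltW // truncnS_gt.
have mpow (D : set R) : measurable_fun D (fun x : R => x `^ (s - 1)).
  by apply: measurable_funTS; exact: measurable_powR.
have cv : ((\int[mu]_(x in F i) (x `^ (s - 1))%:E)%E @[i --> \oo] -->
    (\int[mu]_(x in \bigcup_i F i) (x `^ (s - 1))%:E)%E).
  apply: ge0_nondecreasing_set_cvg_integral.
  - move=> i j ij; apply/subsetPset => x; rewrite /F /= !in_itv /= => /andP[ix ->].
    rewrite andbT (le_trans _ ix) // lef_pV2 ?posrE ?ltr0Sn //.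
    by rewrite ler_nat.
  - by move=> i; exact: measurable_itv.
  - by move=> i; apply/measurable_EFinP; exact: mpow.
  - by move=> i x _; rewrite lee_fin powR_ge0.
have int_F i : (\int[mu]_(x in F i) (x `^ (s - 1))%:E =
    ((1 - (i.+1%:R^-1) `^ s) / s)%:E)%E.
  rewrite /F; have i1 : (i.+1%:R^-1 : R) <= 1 by rewrite invf_le1 // ler1n.
  have ip : 0 < (i.+1%:R^-1 : R) by rewrite invr_gt0.
  (* At i = 0 the interval is the single point 1. *)
  move: i1; rewrite le_eqVlt => /predU1P[->|i1].
    by rewrite set_itv1 integral_set1 powR1 subrr mul0r.
  have pos x : (i.+1%:R^-1 : R) <= x -> 0 < x by exact: lt_le_trans.
  have dpow (p x : R) : 0 < x -> derivable (fun x : R => x `^ p) x 1.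
    by move=> x0; apply: derivable_powR; rewrite in_itv /= x0.
  have cpow (p x : R) : 0 < x -> {for x, continuous (fun x : R => x `^ p)}.
    move=> x0; apply: differentiable_continuous; apply/derivable1_diffP.
    exact: dpow.
  rewrite (@continuous_FTC2 _ _ (fun x => x `^ s / s)) //.
  - by rewrite powR1 -EFinB -mulrBl.
  - apply: derivable_within_continuous => x; rewrite in_itv /= => /andP[ix _].
    exact/dpow/pos.
  - split => [x||].
    + rewrite in_itv /= => /andP[ix _].
      by apply: derivableM => //; apply: dpow; apply: pos; exact: ltW.
    + by apply: cvg_at_right_filter; apply: cvgMl; exact: cpow.
    + by apply: cvg_at_left_filter; apply: cvgMl; exact: cpow.
  - move=> x; rewrite in_itv /= => /andP[ix _].
    have x0 := pos _ (ltW ix).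
    have sN : s != 0 by rewrite gt_eqF.
    rewrite (_ : (fun x => x `^ s / s) = s^-1 \*: (fun x => x `^ s)); last first.
      by apply/funext => z; rewrite /= mulrC.
    rewrite derive1E deriveZ //; last exact: dpow.
    by rewrite -derive1E powR_derive1 ?in_itv /= ?x0 // /GRing.scale /= mulKf.
rewrite -FU; apply: (cvg_unique _ cv) => //.
have E := funext int_F; rewrite E.
apply: cvg_EFin; first exact: nearW.
rewrite [X in _ --> X](_ : _ = (1 - 0) / s); last by rewrite subr0 mul1r.
apply: cvgMr_tmp; apply: cvgB; first exact: cvg_cst.
have /cvg_at_rightP := powR_cvg0 s0.
apply; split; first by move=> i; rewrite invr_gt0.
exact: cvg_harmonic.
Qed.

Lemma measurable_lower_pow s (t : R) :
  measurable_fun setT (fun x : R => pos_pow (s - 1) x * ball_kernel 0 (t - x)).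
Proof.
apply: measurable_funM; first exact: measurable_pos_pow.
by apply: (measurableT_comp (measurable_ball_kernel 0)); apply: measurable_funB.
Qed.

Lemma lower_pow_ge0 s (t x : R) : 0 <= pos_pow (s - 1) x * ball_kernel 0 (t - x).
Proof. exact: mulr_ge0 (pos_pow_ge0 _ _) (ball_kernel_ge0 _ _). Qed.

Lemma ball_kernel0 (w : R) : ball_kernel 0 w = if 0 <= w then 1 else 0.
Proof. by rewrite /ball_kernel powRr0 invr1. Qed.

(** [ball_kernel 0 (t - x)] is the indicator of x <= t; rescaling by t reduces to the interval from
    0 to 1. *)
Lemma integral_lower_pow (s t : R) : 0 < s ->
  (\int[mu]_x (pos_pow (s - 1) x * ball_kernel 0 (t - x))%:E =
   (pos_pow s t / s)%:E)%E.
Proof.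
move=> s0; have [t0|t0] := ltP 0 t; last first.
  rewrite /pos_pow ltNge t0 /= mul0r integral0_eq // => x _.
  case: ltP => x0; last by rewrite mul0r.
  rewrite ball_kernel0 subr_ge0 (_ : (x <= t) = false) ?mulr0 //.
  by apply/negbTE; rewrite -ltNge (le_lt_trans t0).
have int1 : (\int[mu]_x (pos_pow (s - 1) x * ball_kernel 0 (1 - x))%:E = (s^-1)%:E)%E.
  rewrite -integral_powR01 // [RHS]integral_mkcond; apply: eq_integral => x _.
  rewrite patchE /pos_pow ball_kernel0 subr_ge0.
  case: ifPn => x0; last first.
    rewrite mul0r memNset //= in_itv /= => /andP[x0' _].
    by rewrite x0' in x0.
  case: ifPn => x1; first by rewrite mulr1 mem_set //= in_itv /= x0 x1.
  rewrite mulr0 memNset //= in_itv /= => /andP[_ x1'].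
  by rewrite x1' in x1.
rewrite (ge0_integral_affine 0 t0); last 2 first.
- by apply/measurable_EFinP; exact: measurable_lower_pow.
- by move=> x; rewrite lee_fin lower_pow_ge0.
transitivity (t%:E * ((t `^ (s - 1))%:E * (s^-1)%:E))%E.
  congr (_ * _)%E; rewrite -int1 -ge0_integralZlR ?powR_ge0 //; last first.
  - exact: lower_pow_ge0.
  - exact: measurable_lower_pow.
  apply: eq_integral => x _; congr EFin.
  rewrite addr0 (_ : t - t * x = t * (1 - x)); last by rewrite mulrBr mulr1.
  rewrite ball_kernel_hom // -[s - 1]opprK pos_pow_hom // oppr0 powRr0 mul1r.
  by rewrite mulrA.
by rewrite -!EFinM mulrA mulr_powRB1 ?ltW // pos_powE.
Qed.

(* Tonelli for [x^(s-1) e^(-t)] on [0 < x <= t]; this avoids integrating by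
   parts on an unbounded interval. *)
Lemma eGamma_rec (s : R) : 0 < s -> eGamma (s + 1) = (s%:E * eGamma s)%E.
Proof.
move=> s0.
pose f (x t : R) : R := pos_pow (s - 1) x * (expR (- t) * ball_kernel 0 (t - x)).
have f0 x t : 0 <= f x t.
  by apply: mulr_ge0 (pos_pow_ge0 _ _) (mulr_ge0 (expR_ge0 _) (ball_kernel_ge0 _ _)).
have e0 x : 0 <= pos_pow (s - 1) x * expR (- x) :> R.
  exact: mulr_ge0 (pos_pow_ge0 _ _) (expR_ge0 _).
have mf : measurable_fun setT
    (fun p : measurableTypeR R * measurableTypeR R => f p.1 p.2).
  apply: measurable_funM.
    exact: (measurableT_comp (measurable_pos_pow _)).
  apply: measurable_funM.
    by apply: measurableT_comp => //; exact: measurableT_comp.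
  apply: (measurableT_comp (measurable_ball_kernel _)).
  exact: measurable_funB.
have mK (x : R) : measurable_fun setT (fun t : R => expR (- t) * ball_kernel 0 (t - x)).
  apply: measurable_funM; first exact: measurableT_comp.
  by apply: (measurableT_comp (measurable_ball_kernel 0)); apply: measurable_funB.
have K0 (x t : R) : 0 <= expR (- t) * ball_kernel 0 (t - x).
  exact: mulr_ge0 (expR_ge0 _) (ball_kernel_ge0 _ _).
have := ge0_integral_swap mf f0.
have -> : (\int[mu]_x \int[mu]_t (f x t)%:E = eGamma s)%E.
  apply: eq_integral => x _; rewrite ge0_integralZlR ?pos_pow_ge0 //.
  rewrite (ge0_integral_affine x (@ltr01 R)); last 2 first.
  - exact/measurable_EFinP.
  - by move=> t; rewrite lee_fin.
  rewrite mul1e EFinM; congr (_ * _)%E.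
  transitivity ((expR (- x))%:E * kernel_gamma (@ball_kernel 0))%E; last first.
    by rewrite kernel_gamma_ball subr0 eGamma1 mule1.
  rewrite -ge0_integralZlR ?expR_ge0 //; last first.
  - by move=> t; exact: mulr_ge0 (expR_ge0 _) (ball_kernel_ge0 _ _).
  - apply: measurable_funM; first exact: measurableT_comp.
    exact: measurable_ball_kernel.
  apply: eq_integral => t _; congr EFin.
  by rewrite mul1r addrK opprD expRD; ring.
have -> : (\int[mu]_t \int[mu]_x (f x t)%:E = (s^-1)%:E * eGamma (s + 1))%E.
  rewrite -ge0_integralZlR ?invr_ge0 ?ltW //; last first.
  - by move=> t; exact: mulr_ge0 (pos_pow_ge0 _ _) (expR_ge0 _).
  - apply: measurable_funM; [exact: measurable_pos_pow|exact: measurableT_comp].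
  apply: eq_integral => t _.
  transitivity ((expR (- t))%:E * (pos_pow s t / s)%:E)%E; last first.
    by rewrite -EFinM addrK; congr EFin; ring.
  rewrite -integral_lower_pow // -ge0_integralZlR ?expR_ge0 //; last first.
  - exact: lower_pow_ge0.
  - exact: measurable_lower_pow.
  by apply: eq_integral => x _; congr EFin; rewrite /f; ring.
by move=> ->; rewrite muleA -EFinM mulfV ?mul1e ?gt_eqF.
Qed.

Lemma eGamma_ge0 s : (0 <= eGamma s :> \bar R)%E.
Proof.
apply: integral_ge0 => t _; rewrite lee_fin.
exact: mulr_ge0 (pos_pow_ge0 _ _) (expR_ge0 _).
Qed.

Lemma measurable_gamma_term s :
  measurable_fun setT (fun t : R => pos_pow (s - 1) t * expR (- t)).
Proof. by apply: measurable_funM; [exact: measurable_pos_pow|exact: measurableT_comp]. Qed.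

(** At positive integers by the recursion; for other s the integrand is at most t^(s-1) on ]0, 1]
    and, beyond 1, that of an integer n+1 >= s. *)
Lemma eGamma_fin (s : R) : 0 < s -> eGamma s \is a fin_num.
Proof.
move=> s0.
have nat_fin n : eGamma (n.+1%:R : R) \is a fin_num.
  elim: n => [|n IH]; first by rewrite eGamma1.
  by rewrite -natr1 eGamma_rec ?ltr0Sn // fin_numM.
pose n := Num.truncn s; have sn : s <= n.+1%:R by rewrite ltW // truncnS_gt.
rewrite ge0_fin_numE ?eGamma_ge0 //.
apply: (@le_lt_trans _ _ ((s^-1)%:E + eGamma n.+1%:R)%E); last first.
  by rewrite lte_add_pinfty ?ltry // ltey_eq nat_fin.
rewrite (_ : s^-1 = pos_pow s 1 / s); last by rewrite pos_powE // powR1 mul1r.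
rewrite -integral_lower_pow //.
rewrite -ge0_integralD //; last 4 first.
- by move=> t _; rewrite lee_fin lower_pow_ge0.
- by apply/measurable_EFinP; exact: measurable_lower_pow.
- by move=> t _; rewrite lee_fin; exact: mulr_ge0 (pos_pow_ge0 _ _) (expR_ge0 _).
- by apply/measurable_EFinP; exact: measurable_gamma_term.
apply: ge0_le_integral => //.
- by move=> t _; rewrite lee_fin; exact: mulr_ge0 (pos_pow_ge0 _ _) (expR_ge0 _).
- by apply/measurable_EFinP; exact: measurable_gamma_term.
- apply/measurable_EFinP; apply: measurable_funD; first exact: measurable_lower_pow.
  exact: measurable_gamma_term.
move=> t _; rewrite -EFinD lee_fin /pos_pow; case: ltP => t0; last first.
  by rewrite !mul0r addr0.
rewrite ball_kernel0 subr_ge0; case: (leP t 1) => t1.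
  rewrite mulr1 -[leLHS]addr0 lerD //; last first.
    by rewrite mulr_ge0 ?powR_ge0 ?expR_ge0.
  by rewrite ler_piMr ?powR_ge0 // -expR0 ler_expR oppr_le0 ltW.
rewrite mulr0 add0r ler_wpM2r ?expR_ge0 //.
by apply: ler_powR; [exact: ltW|rewrite lerD2r].
Qed.

(** On ]0, 1] the exponential is at least 1/e, which leaves a positive elementary integral. *)
Lemma eGamma_gt0 (s : R) : 0 < s -> (0 < eGamma s)%E.
Proof.
move=> s0; apply: (@lt_le_trans _ _ ((expR (- 1))%:E * (s^-1)%:E)%E).
  by rewrite -EFinM lte_fin mulr_gt0 ?expR_gt0 ?invr_gt0.
rewrite (_ : s^-1 = pos_pow s 1 / s); last by rewrite pos_powE // powR1 mul1r.
rewrite -integral_lower_pow //.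
rewrite -ge0_integralZlR ?expR_ge0 //; last first.
- exact: lower_pow_ge0.
- exact: measurable_lower_pow.
apply: ge0_le_integral => //.
- by move=> t _; rewrite lee_fin mulr_ge0 ?expR_ge0 ?lower_pow_ge0.
- apply/measurable_EFinP; apply: measurable_funM => //; exact: measurable_lower_pow.
- by apply/measurable_EFinP; exact: measurable_gamma_term.
move=> t _; rewrite lee_fin ball_kernel0 subr_ge0 mulrC.
case: (leP t 1) => t1; last first.
  by rewrite mulr0 mul0r; exact: mulr_ge0 (pos_pow_ge0 _ _) (expR_ge0 _).
by rewrite mulr1 ler_wpM2l ?pos_pow_ge0 // ler_expR lerN2.
Qed.

Lemma Gamma_eGamma (s : R) : 0 < s -> (Gamma s)%:E = eGamma s.
Proof.
move=> s0; rewrite -[RHS]fineK ?eGamma_fin //; congr (fine _)%:E.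
rewrite integral_mkcond; apply: eq_integral => t _.
rewrite patchE /pos_pow; case: ifPn => t0.
  by rewrite inE /= in_itv /= andbT in t0; rewrite t0.
case: ifPn => t1; last by rewrite mul0r.
by move/negP: t0; case; rewrite inE /= in_itv /= t1.
Qed.

Lemma Gamma_rec (s : R) : 0 < s -> Gamma (s + 1) = s * Gamma s.
Proof.
move=> s0; apply: EFin_inj; rewrite EFinM !Gamma_eGamma ?addr_gt0 //.
exact: eGamma_rec.
Qed.

Lemma Gamma_gt0 (s : R) : 0 < s -> 0 < Gamma s.
Proof. by move=> s0; rewrite -lte_fin Gamma_eGamma // eGamma_gt0. Qed.

End Kernels.

Section Dirichlet.
Variable R : realType.
Local Notation mu := (@lebesgue_measure R).

Lemma natr_half_gt0 (a : nat) : 0 < a%:R + 2^-1 :> R.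
Proof. by rewrite ltr_wpDl ?ler0n // invr_gt0. Qed.

Lemma integral_even_pow a :
  (\int[mu]_(x in `[(-1)%R, 1%R]) (x ^+ (a + a))%:E =
   ((a%:R + 2^-1)^-1 : R)%:E)%E.
Proof.
have N0 : ((a + a).+1%:R : R) != 0 by rewrite pnatr_eq0.
have cpow (n : nat) : continuous (fun x : R => x ^+ n) by exact: exprn_continuous.
have cF : continuous (fun x : R => (a + a).+1%:R^-1 * x ^+ (a + a).+1).
  by move=> x; apply: cvgMl_tmp; exact: cpow.
rewrite (@continuous_FTC2 _ _ (fun x => (a + a).+1%:R^-1 * x ^+ (a + a).+1)) //.
- rewrite -EFinB; congr EFin; rewrite expr1n.
  have -> : (-1) ^+ (a + a).+1 = -1 :> R.
    by rewrite exprS addnn -mul2n exprM sqrrN expr1n expr1n mulr1.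
  have a0 := natr_half_gt0 a.
  have NE : (a + a).+1%:R = 2 * (a%:R + 2^-1) :> R.
    by rewrite -[(a + a).+1]addn1 !natrD mulrDr mulfV ?pnatr_eq0 //; ring.
  by rewrite NE; field; rewrite gt_eqF.
- by apply: continuous_subspaceT; exact: cpow.
- split => [x _||].
  + by apply: derivableM => //; exact: exprn_derivable.
  + exact/cvg_at_right_filter/cF.
  + exact/cvg_at_left_filter/cF.
- move=> x _; rewrite derive1E.
  rewrite (_ : (fun x => _) = (a + a).+1%:R^-1 \*: (fun x : R => x ^+ (a + a).+1)) //.
  rewrite deriveZ //; last exact: exprn_derivable.
  rewrite exp_derive /GRing.scale /=.
  by rewrite mulr1 -mulr_natl mulrA mulVf ?mul1r.
Qed.

(* [slice_gamma] for the kernel of exponent 0, whose slice is elementary. *)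
Lemma even_gaussE a : even_gauss R a = (Gamma (a%:R + 2^-1))%:E.
Proof.
have a0 := natr_half_gt0 a.
have := @slice_gamma R (ball_kernel 0) 0 a (measurable_ball_kernel 0)
  (ball_kernel_ge0 0) (ball_kernelN1 0) (ball_kernel_hom 0).
rewrite kernel_gamma_ball !subr0 eGamma1 mul1e => <-.
have -> : slice (ball_kernel 0) a 1 = ((a%:R + 2^-1)^-1)%:E :> \bar R.
  rewrite -integral_even_pow [RHS]integral_mkcond; apply: eq_integral => x _.
  rewrite patchE ball_kernel0 subr_ge0.
  have xE : (x ^+ 2 <= 1) = (-1 <= x <= 1).
    by rewrite -ler_norml -[x ^+ 2]real_normK ?num_real // expr_le1.
  case: ifPn => x1.
    by rewrite mulr1 mem_set //= in_itv /= -xE x1.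
  by rewrite mulr0 memNset //= in_itv /= -xE; apply/negP.
by rewrite eGamma_rec // -Gamma_eGamma // muleA -EFinM mulVf ?mul1r // gt_eqF.
Qed.

Lemma Gamma_half : Gamma (2^-1) = Num.sqrt pi :> R.
Proof.
have := even_gaussE 0; rewrite add0r => E; apply: EFin_inj.
rewrite -E -integralT_gauss; apply: eq_integral => x _.
by rewrite /gauss_fun mul1r.
Qed.

(** The Beta value B(1 - s, a + 1/2). *)
Definition slice_const (a : nat) (s : R) : R :=
  Gamma (1 - s) * Gamma (a%:R + 2^-1) / Gamma (a%:R + 2^-1 - s + 1).

Section SliceValue.
Variables (K : R -> R) (s : R).
Hypothesis s1 : s < 1.
Hypothesis mK : measurable_fun setT K.
Hypothesis K0 : forall t, 0 <= K t.
Hypothesis KN1 : K (- 1) = 0.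
Hypothesis Khom : forall t w, 0 < t -> K (t * w) = t `^ (- s) * K w.
Hypothesis Kgamma : kernel_gamma K = eGamma (1 - s).

Lemma sliceE a t :
  slice K a t = (slice_const a s * pos_pow (a%:R + 2^-1 - s) t)%:E.
Proof.
have [t0|t0] := ltP 0 t; last first.
  by rewrite (slice_nonpos a KN1 Khom t0) /pos_pow ltNge t0 /= mulr0.
rewrite (slice_pos a mK K0 Khom t0) pos_powE // mulrC EFinM; congr (_ * _)%E.
have s1' : 0 < 1 - s by rewrite subr_gt0.
have a0 := natr_half_gt0 a.
have p0 : 0 < a%:R + 2^-1 - s + 1 by rewrite addrAC -addrA addr_gt0.
have := slice_gamma a mK K0 KN1 Khom.
rewrite Kgamma even_gaussE -!Gamma_eGamma //.
have G0 := Gamma_gt0 p0.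
have J0 : (0 <= slice K a 1)%E.
  by apply: integral_ge0 => x _; rewrite lee_fin mulr_ge0 ?expr_even_ge0.
(* The slice at 1 is not known to be finite beforehand; an infinite value would contradict
   [slice_gamma], whose right side is finite while the Gamma factor on the left is positive. *)
move: J0; case: (slice K a 1) => [x| |] // _.
  by rewrite -!EFinM => -[E]; congr EFin; rewrite /slice_const -E mulfK ?gt_eqF.
by rewrite gt0_mulye // lte_fin.
Qed.

End SliceValue.

Lemma slice_ball a (s t : R) : s < 1 ->
  slice (ball_kernel s) a t = (slice_const a s * pos_pow (a%:R + 2^-1 - s) t)%:E.
Proof.
move=> s1; apply: sliceE => //.
- exact: measurable_ball_kernel.
- exact: ball_kernel_ge0.
- exact: ball_kernelN1.
- by move=> *; exact: ball_kernel_hom.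
- exact: kernel_gamma_ball.
Qed.

Lemma slice_pow a (s t : R) : s < 1 ->
  slice (pos_pow (- s)) a t = (slice_const a s * pos_pow (a%:R + 2^-1 - s) t)%:E.
Proof.
move=> s1; apply: sliceE => //.
- exact: measurable_pos_pow.
- exact: pos_pow_ge0.
- exact: pos_powN1.
- by move=> *; exact: pos_pow_hom.
- exact: kernel_gamma_pos.
Qed.

Local Notation mR := (measurableTypeR R).
Local Notation mu3 := (mu \x mu \x mu)%E.

Lemma sigma_finite_lebesgue2 : sigma_finite setT (mu \x mu)%E.
Proof.
pose I (n : nat) : set mR := `[- (n%:R : R), n%:R]%classic.
exists (fun n => I n `*` I n) => [|n].
  apply/seteqP; split => // -[x y] _.
  pose n := (Num.truncn `|x| + Num.truncn `|y|).+1.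
  have lexn (w : R) : (Num.truncn `|w| < n)%N -> I n w.
    move=> wn; rewrite /I /= in_itv /= -ler_norml ltW //.
    by rewrite (lt_le_trans (truncnS_gt _)) // ler_nat.
  by exists n => //; split; apply: lexn; rewrite ltnS ?leq_addl ?leq_addr.
split; first by apply: measurableX; exact: measurable_itv.
rewrite [X in (X < _)%E]product_measure1E; try exact: measurable_itv.
have In : (mu (I n) < +oo)%E.
  by rewrite /I lebesgue_measure_itv /= lte_fin; case: ifP => _; rewrite ?ltry.
have In0 : (0 <= mu (I n))%E by exact: measure_ge0.
by apply: lte_mul_pinfty => //; rewrite ge0_fin_numE.
Qed.

(** The double product packed as a sigma-finite measure, as Tonelli's theorem for the triple product
    requires. *)
Definition lebesgue2 : {sigma_finite_measure set (mR * mR)%type -> \bar R} :=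
  HB.pack (mu \x mu)%E
    (Measure_isSigmaFinite.Build _ _ _ (mu \x mu)%E sigma_finite_lebesgue2).

Lemma ge0_integral3 (f : mR * mR * mR -> R) : measurable_fun setT f ->
  (forall p, 0 <= f p) ->
  (\int[mu3]_p (f p)%:E = \int[mu]_z \int[mu]_y \int[mu]_x (f (x, y, z))%:E)%E.
Proof.
move=> mf f0.
pose g (p : mR * mR * mR) := (f p)%:E.
have mg : measurable_fun setT g by exact/measurable_EFinP.
have g0 p : (0 <= g p)%E by rewrite lee_fin.
transitivity (\int[mu]_z fubini_G lebesgue2 g z)%E.
  exact: (fubini_tonelli2 (m1 := lebesgue2) (m2 := mu) g mg g0).
apply: eq_integral => z _; rewrite /fubini_G.
pose h (q : mR * mR) := g (q, z).
have mh : measurable_fun setT h.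
  exact: (measurableT_comp mg (measurable_pair2 z)).
have h0 q : (0 <= h q)%E by exact: g0.
exact: (fubini_tonelli2 h mh h0).
Qed.

(** Three slices in succession. The Gamma value in the denominator of each slice constant is the one
    in the numerator of the next, so the product telescopes. *)
Lemma dirichlet (a b c : nat) (s : R) : s < 1 ->
  (\int[mu3]_p ((p.1.1 : R) ^+ (a + a) * (p.1.2 : R) ^+ (b + b) * (p.2 : R) ^+ (c + c) *
     ball_kernel s (1 - p.1.1 ^+ 2 - p.1.2 ^+ 2 - p.2 ^+ 2))%:E =
  (Gamma (1 - s) * Gamma (a%:R + 2^-1) * Gamma (b%:R + 2^-1) * Gamma (c%:R + 2^-1) /
    Gamma ((a + b + c)%:R + 5 / 2 - s))%:E)%E.
Proof.
move=> s1; rewrite ge0_integral3; last 2 first.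
- apply: measurable_funM; last first.
    apply: (measurableT_comp (measurable_ball_kernel s)).
    apply: measurable_funB; [apply: measurable_funB; [apply: measurable_funB => //|]|];
      apply: measurable_funX => //; exact: measurableT_comp.
  by do 2?[apply: measurable_funM]; apply: measurable_funX => //;
    exact: measurableT_comp.
- by move=> p; rewrite !mulr_ge0 ?expr_even_ge0 ?ball_kernel_ge0.
(* The exponents of the kernels left after integrating out x, and then y. *)
pose s2 : R := s - (a%:R + 2^-1); pose s3 : R := s2 - (b%:R + 2^-1).
have a0 := natr_half_gt0 a; have b0 := natr_half_gt0 b; have c0 := natr_half_gt0 c.
have s21 : s2 < 1 by rewrite /s2; lra.
have s31 : s3 < 1 by rewrite /s3; lra.
have sc0 k t : t < 1 -> 0 <= slice_const k t.
  move=> t1; have k0 := natr_half_gt0 k.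
  by rewrite /slice_const !mulr_ge0 ?invr_ge0 ?ltW // Gamma_gt0 //; lra.
transitivity (\int[mu]_z (slice_const a s * slice_const b s2 *
    (z ^+ (c + c) * pos_pow (- s3) (1 - z ^+ 2)))%:E)%E; last first.
  rewrite ge0_integralZlR; first last.
  - by move=> z; rewrite mulr_ge0 ?expr_even_ge0 ?pos_pow_ge0.
  - exact: (measurable_slice c (measurable_pos_pow _) 1).
  - by apply: mulr_ge0; exact: sc0.
  have := slice_pow c 1 s31; rewrite /slice => ->; rewrite pos_powE // powR1 mulr1 -EFinM; congr EFin.
  rewrite /slice_const.
  have e2 : 1 - s2 = a%:R + 2^-1 - s + 1 by rewrite /s2; ring.
  have e3 : 1 - s3 = b%:R + 2^-1 - s2 + 1 by rewrite /s3; ring.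
  have e4 : (a + b + c)%:R + 5 / 2 - s = c%:R + 2^-1 - s3 + 1.
    by rewrite /s3 /s2 !natrD; field.
  rewrite e2 e3 e4.
  have nz t : 0 < t -> Gamma t != 0 :> R by move=> t0; rewrite gt_eqF // Gamma_gt0.
  have g2 : Gamma (a%:R + 2^-1 - s + 1) != 0 by apply: nz; rewrite -e2; lra.
  have g3 : Gamma (b%:R + 2^-1 - s2 + 1) != 0 by apply: nz; rewrite -e3; lra.
  move: (Gamma (a%:R + 2^-1 - s + 1)) (Gamma (b%:R + 2^-1 - s2 + 1)) g2 g3 => x y x0 y0.
  move: (Gamma (c%:R + 2^-1 - s3 + 1)) (Gamma (a%:R + 2^-1)) (Gamma (b%:R + 2^-1)) => w x' y'.
  move: (Gamma (c%:R + 2^-1)) (Gamma (1 - s)) => w' z'.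
  (* [field] needs w nonzero; with 0^-1 = 0 both sides vanish otherwise. *)
  have [->|w0] := eqVneq w 0; first by rewrite invr0 !mulr0.
  by field; rewrite w0 x0 y0.
apply: eq_integral => z _.
transitivity (\int[mu]_y (slice_const a s * z ^+ (c + c) *
    (y ^+ (b + b) * pos_pow (- s2) (1 - z ^+ 2 - y ^+ 2)))%:E)%E; last first.
  rewrite ge0_integralZlR; first last.
  - by move=> y; rewrite mulr_ge0 ?expr_even_ge0 ?pos_pow_ge0.
  - exact: (measurable_slice b (measurable_pos_pow _) (1 - z ^+ 2)).
  - by apply: mulr_ge0; [exact: sc0|exact: expr_even_ge0].
  have := slice_pow b (1 - z ^+ 2) s21; rewrite /slice => ->; rewrite -EFinM; congr EFin.
  by rewrite (_ : b%:R + 2^-1 - s2 = - s3) ?/s3 ?opprB //; ring.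
apply: eq_integral => y _.
transitivity (\int[mu]_x (y ^+ (b + b) * z ^+ (c + c) *
    (x ^+ (a + a) * ball_kernel s (1 - z ^+ 2 - y ^+ 2 - x ^+ 2)))%:E)%E.
  apply: eq_integral => x _; congr EFin; rewrite /=.
  rewrite (_ : 1 - x ^+ 2 - y ^+ 2 - z ^+ 2 = 1 - z ^+ 2 - y ^+ 2 - x ^+ 2); ring.
rewrite ge0_integralZlR ?mulr_ge0 ?expr_even_ge0 //; last first.
- by move=> x; rewrite mulr_ge0 ?expr_even_ge0 ?ball_kernel_ge0.
- exact: (measurable_slice a (measurable_ball_kernel _) (1 - z ^+ 2 - y ^+ 2)).
have := slice_ball a (1 - z ^+ 2 - y ^+ 2) s1; rewrite /slice => ->; rewrite -EFinM; congr EFin.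
by rewrite (_ : a%:R + 2^-1 - s = - s2) ?/s2 ?opprB //; ring.
Qed.

End Dirichlet.

(** * Moments of the prior *)

Section BallFunctional.
Variable R : realType.
Local Notation mu := (@lebesgue_measure R).
Local Notation mR := (measurableTypeR R).
Local Notation mR3 := (mR * mR * mR)%type.
Local Notation mu3 := (mu \x mu \x mu)%E.

Definition one_sub_r2 (p : mR3) : R := 1 - p.1.1 ^+ 2 - p.1.2 ^+ 2 - p.2 ^+ 2.

Definition monomial (a b c : nat) (p : mR3) : R :=
  (p.1.1 : R) ^+ a * (p.1.2 : R) ^+ b * (p.2 : R) ^+ c.

Lemma measurable_coords :
  [/\ measurable_fun setT (fun p : mR3 => p.1.1),
      measurable_fun setT (fun p : mR3 => p.1.2) &
      measurable_fun setT (fun p : mR3 => p.2)].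
Proof. by split => //; exact: measurableT_comp. Qed.

Lemma measurable_one_sub_r2 : measurable_fun setT one_sub_r2.
Proof.
have [mx my mz] := measurable_coords.
by apply: measurable_funB; [apply: measurable_funB; [apply: measurable_funB|]|];
  rewrite //; exact: measurable_funX.
Qed.

Lemma measurable_monomial a b c : measurable_fun setT (monomial a b c).
Proof.
have [mx my mz] := measurable_coords.
by apply: measurable_funM; [apply: measurable_funM|]; exact: measurable_funX.
Qed.

Definition flip (s : bool * bool * bool) (p : mR3) : mR3 :=
  ((-1) ^+ s.1.1 * p.1.1, (-1) ^+ s.1.2 * p.1.2, (-1) ^+ s.2 * p.2).

Lemma measurable_flip s : measurable_fun setT (flip s).
Proof.
have [mx my mz] := measurable_coords.
by apply/measurable_fun_pairP; split; [apply/measurable_fun_pairP; split|];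
  rewrite /comp /flip /=; exact: measurable_funM.
Qed.

(** One reflection per coordinate under the iterated integral; this needs the partial integrals [G2]
    and [G3] to be measurable. *)
Lemma ge0_integral_flip s (f : mR3 -> R) : measurable_fun setT f ->
  (forall p, 0 <= f p) -> (\int[mu3]_p (f (flip s p))%:E = \int[mu3]_p (f p)%:E)%E.
Proof.
move=> mf f0.
have sgn1 (e : bool) (h : R -> \bar R) : measurable_fun setT h ->
    (forall x, (0 <= h x)%E) ->
    (\int[mu]_x h ((-1) ^+ e * x)%R = \int[mu]_x h x)%E.
  move=> mh h0; case: e; last by apply: eq_integral => x _; rewrite expr0 mul1r.
  rewrite [RHS]ge0_integral_opp //; apply: eq_integral => x _.
  by rewrite expr1 mulN1r.
have mfs : measurable_fun setT (fun p => f (flip s p)).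
  exact: (measurableT_comp mf (measurable_flip s)).
have fs0 p : 0 <= f (flip s p) by exact: f0.
rewrite (ge0_integral3 mfs fs0) (ge0_integral3 mf f0).
pose g (p : mR3) := (f p)%:E.
have mg : measurable_fun setT g by exact/measurable_EFinP.
have g0 p : (0 <= g p)%E by rewrite lee_fin.
pose h z (q : mR * mR) := g (q, z).
have mh z : measurable_fun setT (h z).
  exact: (measurableT_comp mg (measurable_pair2 z)).
have h0 z q : (0 <= h z q)%E by exact: g0.
pose G2 (z y : mR) : \bar R := (\int[mu]_x (f (x, y, z))%:E)%E.
pose G3 (z : mR) : \bar R := (\int[mu]_y G2 z y)%E.
have G20 z y : (0 <= G2 z y)%E by apply: integral_ge0 => x _; rewrite lee_fin.
have G30 z : (0 <= G3 z)%E by apply: integral_ge0 => x _; exact: G20.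
have mG2 z : measurable_fun setT (G2 z).
  exact: (measurable_fun_fubini_tonelli_G (m1 := mu) (h z) (mh z) (h0 z)).
have mG3 : measurable_fun setT G3.
  have -> : G3 = fubini_G (lebesgue2 R) g.
    by apply/funext => z; exact: esym (fubini_tonelli2 (m1 := mu) (m2 := mu) (h z) (mh z) (h0 z)).
  exact: (measurable_fun_fubini_tonelli_G (m1 := lebesgue2 R) g mg g0).
rewrite -[RHS](sgn1 s.2 G3 mG3 G30); apply: eq_integral => z _.
rewrite -[RHS](sgn1 s.1.2 (G2 _) (mG2 _) (G20 _)); apply: eq_integral => y _.
apply: (sgn1 s.1.1 (fun x => (f (x, (-1) ^+ s.1.2 * y, (-1) ^+ s.2 * z))%:E)) => //.
  exact: (measurableT_comp (mh _) (measurable_pair2 _)).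
by move=> x; rewrite lee_fin.
Qed.

(* If both parts have infinite integral, this is [fine (+oo - +oo) = 0]. *)
Lemma Rintegral_odd s (f : mR3 -> R) : measurable_fun setT f ->
  (forall p, f (flip s p) = - f p) -> \int[mu3]_p f p = 0.
Proof.
move=> mf fodd; rewrite /Rintegral integralE.
have -> : (\int[mu3]_p (fun x => (f x)%:E)^\- p = \int[mu3]_p (fun x => (f x)%:E)^\+ p)%E.
  transitivity (\int[mu3]_p (f^\+ (flip s p))%:E)%E.
    apply: eq_integral => p _; rewrite funenegE /funrpos fodd.
    by rewrite -EFinN -EFin_max.
  rewrite ge0_integral_flip //.
  - by apply: eq_integral => p _; rewrite funeposE /funrpos EFin_max.
  - exact: measurable_funrpos.
by case: integral => [x| |] //=; rewrite subrr.
Qed.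

(** [prior_density] extended by 0, so that integrals over the ball become integrals over the whole
    space. *)
Definition ball_dens (u : R) (p : mR3) : R :=
  Gamma (5 / 2 - u) / (pi `^ (3 / 2) * Gamma (1 - u)) * ball_kernel u (one_sub_r2 p).

Definition ball_mean (u : R) (f : mR3 -> R) : R := \int[mu3]_p (ball_dens u p * f p).

(** Sufficient for integrability against a density vanishing off the ball, and stable under sums and
    products. *)
Definition ball_bounded (f : mR3 -> R) : Prop :=
  measurable_fun setT f /\
  exists C : R, forall p, 0 <= one_sub_r2 p -> `|f p| <= C.

Lemma ball_bounded_cst c : ball_bounded (fun=> c).
Proof. by split => //; exists `|c|. Qed.

Lemma ball_boundedD f g : ball_bounded f -> ball_bounded g ->
  ball_bounded (fun p => f p + g p).
Proof.
move=> [mf [C fC]] [mg [D gD]]; split; first exact: measurable_funD.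
by exists (C + D) => p p1; rewrite (le_trans (ler_normD _ _)) // lerD ?fC ?gD.
Qed.

Lemma ball_boundedM f g : ball_bounded f -> ball_bounded g ->
  ball_bounded (fun p => f p * g p).
Proof.
move=> [mf [C fC]] [mg [D gD]]; split; first exact: measurable_funM.
by exists (C * D) => p p1; rewrite normrM ler_pM ?fC ?gD.
Qed.

Lemma ball_bounded_coords :
  [/\ ball_bounded (fun p => p.1.1), ball_bounded (fun p => p.1.2) &
      ball_bounded (fun p => p.2)].
Proof.
have [mx my mz] := measurable_coords.
have sq (a b c : R) : 0 <= 1 - a ^+ 2 - b ^+ 2 - c ^+ 2 -> `|a| <= 1.
  move=> H; rewrite -(@expr_le1 _ 2) // real_normK ?num_real //.
  have := sqr_ge0 b; have := sqr_ge0 c; lra.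
split; split => //; exists 1 => p; rewrite /one_sub_r2 => H.
- exact: (sq _ _ _ H).
- by apply: (sq _ p.1.1 p.2); move: H; lra.
- by apply: (sq _ p.1.1 p.1.2); move: H; lra.
Qed.

Lemma ball_bounded_pow f n : ball_bounded f -> ball_bounded (fun p => f p ^+ n).
Proof.
move=> bf; elim: n => [|n IH]; first exact: ball_bounded_cst.
under eq_fun do rewrite exprS; exact: ball_boundedM.
Qed.

End BallFunctional.

Section GaussMoment.
Variable F : numFieldType.

(* The [j]-th moment of the centred normal law of variance 1/2. *)
Definition gauss_moment (j : nat) : F :=
  if odd j then 0 else j`!%:R / (4 ^+ j./2 * (j./2)`!%:R).

Lemma gauss_moment_rec j : gauss_moment j.+2 = (j.+1%:R / 2) * gauss_moment j.
Proof.
rewrite /gauss_moment /= negbK; case: ifP => oj; first by rewrite mulr0.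
have jE : j = (j./2).*2 by rewrite -[LHS]odd_double_half oj.
have f0 : (j./2)`!%:R != 0 :> F by rewrite pnatr_eq0 -lt0n fact_gt0.
have p0 : (4 : F) ^+ j./2 != 0 by rewrite expf_eq0 pnatr_eq0 andbF.
have s0 : (j./2).+1%:R != 0 :> F by rewrite pnatr_eq0.
rewrite !factS !natrM exprS.
have -> : j.+2%:R = 2 * (j./2).+1%:R :> F.
  by rewrite {1}jE -natrM mul2n doubleS.
by field; rewrite f0 p0 addrC natr1.
Qed.

Lemma sum_even_terms (V : nmodType) m (f : nat -> V) : (forall i, odd i -> f i = 0) ->
  \sum_(i < m.*2.+1) f i = \sum_(i < m.+1) f i.*2.
Proof.
move=> f0; elim: m => [|m IH]; first by rewrite !big_ord1.
rewrite [RHS]big_ord_recr /= -IH doubleS [LHS]big_ord_recr /=.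
by rewrite [in LHS]big_ord_recr /= (f0 m.*2.+1) ?addr0 //= odd_double.
Qed.

(* The sum of independent centred normal variables of variances [s/2] and [t/2]
   is normal of variance [(s + t)/2]; this is what rotation invariance of the
   density amounts to on moments. *)
Lemma gauss_moment_conv j (s t : F) :
  \sum_(i < j.+1) 'C(j, i)%:R *
     (gauss_moment (j - i) * s ^+ (j - i)./2 * (gauss_moment i * t ^+ i./2)) =
  gauss_moment j * (s + t) ^+ j./2.
Proof.
have [oj|ej] := boolP (odd j).
  rewrite [in RHS]/gauss_moment oj mul0r big1 // => i _; rewrite /gauss_moment.
  have := ltn_ord i; rewrite ltnS => ij; rewrite oddB // oj /=.
  by case: (odd i); rewrite /= ?mul0r ?mulr0.
have -> : j = j./2.*2 by rewrite -[LHS]odd_double_half (negbTE ej).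
move: (j./2) => {j ej} m.
rewrite (@sum_even_terms _ m (fun i => 'C(m.*2, i)%:R *
     (gauss_moment (m.*2 - i) * s ^+ (m.*2 - i)./2 * (gauss_moment i * t ^+ i./2)))); last first.
  by move=> i oi; rewrite /gauss_moment oi mul0r !mulr0.
rewrite doubleK exprDn mulr_sumr; apply: eq_bigr => -[i im] _ /=.
rewrite ltnS in im; rewrite -doubleB /gauss_moment !odd_double !doubleK.
have fn0 n : n`!%:R != 0 :> F by rewrite pnatr_eq0 -lt0n fact_gt0.
have four n : (4 : F) ^+ n != 0 by rewrite expf_eq0 pnatr_eq0 andbF.
have E1 : (m.*2)`!%:R = 'C(m.*2, i.*2)%:R * ((i.*2)`!%:R * ((m - i).*2)`!%:R) :> F.
  by rewrite -!natrM doubleB bin_fact // leq_double.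
have E2 : 'C(m, i)%:R = m`!%:R / (i`!%:R * (m - i)`!%:R) :> F.
  rewrite -(bin_fact im) !natrM mulfK // mulf_neq0 //.
have E3 : (4 : F) ^+ m = 4 ^+ (m - i) * 4 ^+ i by rewrite -exprD subnK.
rewrite -[_ *+ 'C(m, i)]mulr_natl E1 E2 E3.
move: (4 ^+ (m - i)) (four (m - i)%N) (4 ^+ i) (four i) => x x0 y y0.
move: (m`!%:R) (fn0 m) ((m - i)`!%:R) (fn0 (m - i)%N) (i`!%:R) (fn0 i) => a a0 b b0 c c0.
by field; rewrite ?x0 ?y0 ?a0 ?b0 ?c0.
Qed.

End GaussMoment.

Section Moments.
Variable R : realType.
Local Notation mu := (@lebesgue_measure R).
Local Notation mR := (measurableTypeR R).
Local Notation mR3 := (mR * mR * mR)%type.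
Local Notation mu3 := (mu \x mu \x mu)%E.
Variable u : R.
Hypothesis u1 : u < 1.

Lemma dens_const_ge0 : 0 <= Gamma (5 / 2 - u) / (pi `^ (3 / 2) * Gamma (1 - u)).
Proof.
have := u1; move=> lt_u1.
apply: divr_ge0; first by apply/ltW/Gamma_gt0; lra.
by apply: mulr_ge0; [exact: powR_ge0 | apply/ltW/Gamma_gt0; lra].
Qed.

Lemma ball_dens_ge0 p : 0 <= ball_dens u p.
Proof.
exact: mulr_ge0 dens_const_ge0 (ball_kernel_ge0 _ _).
Qed.

Lemma measurable_ball_dens : measurable_fun setT (ball_dens u : mR3 -> R).
Proof.
apply: measurable_funM => //.
exact: (measurableT_comp (measurable_ball_kernel u) (@measurable_one_sub_r2 R)).
Qed.

Lemma ball_dens_out p : one_sub_r2 p < 0 -> ball_dens u p = 0.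
Proof. by move=> p0; rewrite /ball_dens /ball_kernel leNgt p0 mulr0. Qed.

Lemma integral_ball_dens : (\int[mu3]_p (ball_dens u p)%:E < +oo)%E.
Proof.
under eq_integral => p _ do rewrite /ball_dens EFinM.
rewrite ge0_integralZl_EFin //; last 3 first.
- by move=> p _; rewrite lee_fin ball_kernel_ge0.
- apply/measurable_EFinP.
  exact: (measurableT_comp (measurable_ball_kernel u) (@measurable_one_sub_r2 R)).
- exact: dens_const_ge0.
have := dirichlet 0 0 0 u1.
set I := (X in X = _ -> _); have -> : (\int[mu3]_p (ball_kernel u (one_sub_r2 p))%:E = I)%E.
  by apply: eq_integral => p _; congr EFin; rewrite /one_sub_r2 !mul1r.
by move=> ->; rewrite -EFinM ltry.
Qed.

Lemma integrable_ball_dens f : ball_bounded f ->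
  mu3.-integrable setT (EFin \o (fun p => ball_dens u p * f p)).
Proof.
move=> [mf [C fC]].
have int1 : mu3.-integrable setT (EFin \o ball_dens u).
  apply/integrableP; split; first by apply/measurable_EFinP; exact: measurable_ball_dens.
  under eq_integral => p _ do rewrite /= ger0_norm ?ball_dens_ge0 //.
  exact: integral_ball_dens.
have := @integrableZl _ _ _ mu3 setT (measurableT) `|C| _ int1.
apply: le_integrable => //.
  by apply/measurable_EFinP; apply: measurable_funM => //; exact: measurable_ball_dens.
move=> p _; rewrite /= lee_fin normrM [leRHS]normrM normr_id mulrC.
have [p0|p0] := leP 0 (one_sub_r2 p).
  by rewrite ler_wpM2r // (le_trans (fC p p0)) // ler_norm.
by rewrite ball_dens_out // normr0 !mulr0.
Qed.

Lemma ball_meanD f g : ball_bounded f -> ball_bounded g ->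
  ball_mean u (fun p => f p + g p) = ball_mean u f + ball_mean u g.
Proof.
move=> bf bg; rewrite /ball_mean -RintegralD //; try exact: integrable_ball_dens.
by apply: eq_Rintegral => p _; rewrite /= mulrDr.
Qed.

Lemma ball_meanZ c f : ball_bounded f ->
  ball_mean u (fun p => c * f p) = c * ball_mean u f.
Proof.
move=> bf; rewrite /ball_mean -RintegralZl //; last exact: integrable_ball_dens.
by apply: eq_Rintegral => p _; rewrite /= mulrCA.
Qed.

Lemma Gamma_half_nat a :
  Gamma (a%:R + 2^-1) = Num.sqrt pi * gauss_moment R (a + a) :> R.
Proof.
elim: a => [|a IH].
  by rewrite add0r Gamma_half /gauss_moment /= fact0 expr0 mul1r divr1 mulr1.
rewrite -natr1 addrAC Gamma_rec ?natr_half_gt0 // IH addSn addnS gauss_moment_rec.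
by rewrite -[(a + a).+1]addn1 !natrD; field.
Qed.

(** What is left of Dirichlet's value, for the weight (1 - r^2)^d, once the Gaussian moments are
    split off; sqrt(pi)^3 cancels pi^(3/2). It depends on the monomial only through its total degree
    2N, and this expresses rotation invariance. *)
Definition radial_const (d N : nat) : R :=
  Gamma (5 / 2 - u) * Gamma (1 - u + d%:R) / Gamma (1 - u) /
  Gamma (N%:R + 5 / 2 - u + d%:R).

(** The determinant factor is absorbed by replacing u with u - d. At w = 0 and d > 0 both sides are
    0, as u - d is nonzero. *)
Lemma ball_kernel_shift (d : nat) w :
  w ^+ d * ball_kernel u w = ball_kernel (u - d%:R) w.
Proof.
rewrite /ball_kernel; case: ifP => w0; last by rewrite mulr0.
case: d => [|d]; first by rewrite expr0 mul1r subr0.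
move: w0; rewrite le_eqVlt => /predU1P[<-|w0].
  have d1 : 1 <= d.+1%:R :> R by rewrite ler1n.
  have lt_u1 := u1; rewrite exprS !mul0r powR0 ?invr0 //.
  by rewrite lt_eqF //; lra.
by rewrite -!powRN opprB -(powR_mulrn _ (ltW w0)) [RHS]powRD // (gt_eqF w0) implybT.
Qed.

Lemma ball_bounded_monomial a b c : ball_bounded (@monomial R a b c).
Proof.
have [bx by_ bz] := @ball_bounded_coords R.
by apply: ball_boundedM; [apply: ball_boundedM|]; exact: ball_bounded_pow.
Qed.

Lemma ball_bounded_r2 d : ball_bounded (fun p : mR3 => one_sub_r2 p ^+ d).
Proof.
have [bx by_ bz] := @ball_bounded_coords R.
apply: ball_bounded_pow.
have -> : @one_sub_r2 R = fun p => 1 + (-1 * p.1.1 ^+ 2) + (-1 * p.1.2 ^+ 2) + (-1 * p.2 ^+ 2).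
  by apply/funext => p; rewrite /one_sub_r2 !mulN1r.
apply: ball_boundedD; [apply: ball_boundedD; [apply: ball_boundedD; [exact: ball_bounded_cst|]|]|];
  by apply: ball_boundedM; [exact: ball_bounded_cst|exact: ball_bounded_pow].
Qed.

Lemma ball_mean_monomial a b c d :
  ball_mean u (fun p => monomial a b c p * one_sub_r2 p ^+ d) =
  gauss_moment R a * gauss_moment R b * gauss_moment R c * radial_const d (a + b + c)./2.
Proof.
have mf : measurable_fun setT (fun p : mR3 => ball_dens u p * (monomial a b c p * one_sub_r2 p ^+ d)).
  apply: measurable_funM; first exact: measurable_ball_dens.
  apply: measurable_funM; first exact: measurable_monomial.
  by apply: measurable_funX; exact: measurable_one_sub_r2.
have flip_r2 s p : one_sub_r2 (flip s p) = one_sub_r2 p :> R.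
  by rewrite /one_sub_r2 /flip /= !exprMn !sqrr_sign !mul1r.
(* A reflection preserves the density; if the reflected coordinates have odd total exponent, it
   changes the sign of the integrand. *)
have flip_odd (s : bool * bool * bool) : odd (s.1.1 * a + s.1.2 * b + s.2 * c) ->
    ball_mean u (fun p => monomial a b c p * one_sub_r2 p ^+ d) = 0.
  move=> so; rewrite /ball_mean; apply: (Rintegral_odd (s := s) mf) => p.
  rewrite /ball_dens flip_r2 /monomial /flip /= !exprMn -!exprM.
  have -> : (-1) ^+ (s.1.1 * a) = (-1) ^+ (s.1.1 * a + s.1.2 * b + s.2 * c)
      * (-1) ^+ (s.1.2 * b) * (-1) ^+ (s.2 * c) :> R.
    rewrite -!exprD -signr_odd -[RHS]signr_odd; congr (_ ^+ nat_of_bool _).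
    rewrite !oddD; case: (odd _) (odd _) (odd _) => [] [] [] //.
  rewrite -[_ ^+ (_ + _)]signr_odd so expr1.
  have sq e : ((-1) ^+ e) ^+ 2 = 1 :> R by rewrite sqrr_sign.
  transitivity (- (((-1) ^+ (s.1.2 * b)) ^+ 2 * ((-1) ^+ (s.2 * c)) ^+ 2 *
    (Gamma (5 / 2 - u) / (pi `^ (3 / 2) * Gamma (1 - u)) * ball_kernel u (one_sub_r2 p) *
     (p.1.1 ^+ a * p.1.2 ^+ b * p.2 ^+ c * one_sub_r2 p ^+ d)))); first by ring.
  by rewrite !sq !mul1r.
have [oa|ea] := boolP (odd a).
  rewrite (flip_odd (true, false, false)) ?mul1n ?mul0n ?addn0 //.
  by rewrite /gauss_moment oa !mul0r.
have [ob|eb] := boolP (odd b).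
  rewrite (flip_odd (false, true, false)) ?mul1n ?mul0n ?addn0 //.
  by rewrite /gauss_moment ob mulr0 !mul0r.
have [oc|ec] := boolP (odd c).
  rewrite (flip_odd (false, false, true)) ?mul1n ?mul0n ?addn0 ?add0n //.
  by rewrite /gauss_moment oc mulr0 mul0r.
have half k : ~~ odd k -> k = (k./2 + k./2)%N.
  by move=> ek; rewrite addnn -[LHS]odd_double_half (negbTE ek).
rewrite (half a ea) (half b eb) (half c ec).
move: (a./2) (b./2) (c./2) => i j k.
rewrite (_ : _./2 = (i + j + k)%N); last by lia.
rewrite /ball_mean /Rintegral.
pose K := Gamma (5 / 2 - u) / (pi `^ (3 / 2) * Gamma (1 - u)) : R.
have ud : u - d%:R < 1.
  by have lt_u1 := u1; have d0 : 0 <= d%:R :> R by []; lra.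
have -> : (\int[mu3]_p (ball_dens u p *
    (monomial (i + i) (j + j) (k + k) p * one_sub_r2 p ^+ d))%:E =
  K%:E * \int[mu3]_p ((p.1.1 : R) ^+ (i + i) * (p.1.2 : R) ^+ (j + j) * (p.2 : R) ^+ (k + k) *
     ball_kernel (u - d%:R) (1 - p.1.1 ^+ 2 - p.1.2 ^+ 2 - p.2 ^+ 2))%:E)%E.
  rewrite -ge0_integralZl_EFin //; last 3 first.
  - by move=> p _; rewrite lee_fin !mulr_ge0 ?expr_even_ge0 ?ball_kernel_ge0.
  - apply/measurable_EFinP; apply: measurable_funM; first exact: measurable_monomial.
    exact: (measurableT_comp (measurable_ball_kernel _) (@measurable_one_sub_r2 R)).
  - exact: dens_const_ge0.
  apply: eq_integral => p _; rewrite -EFinM; congr EFin.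
  by rewrite /ball_dens -ball_kernel_shift /monomial /one_sub_r2 /K; ring.
rewrite dirichlet // -EFinM /= !Gamma_half_nat /K /radial_const.
have pi32 : pi `^ (3 / 2) = Num.sqrt pi ^+ 3 :> R.
  by rewrite mulrC powRrM powR12_sqrt ?pi_ge0 // -powR_mulrn ?sqrtr_ge0.
rewrite pi32 (_ : 1 - (u - d%:R) = 1 - u + d%:R); last by ring.
rewrite (_ : (i + j + k)%:R + 5 / 2 - (u - d%:R) = (i + j + k)%:R + 5 / 2 - u + d%:R);
  last by ring.
have p0 : Num.sqrt pi != 0 :> R by rewrite sqrtr_eq0 -ltNge pi_gt0.
have lt_u1 := u1.
have g1 : Gamma (1 - u) != 0 by rewrite gt_eqF // Gamma_gt0; lra.
move: (Gamma (1 - u)) g1 (Num.sqrt pi) p0 => x x0 y y0.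
move: (Gamma (_ + 5 / 2 - u + _)) => w.
have [->|w0] := eqVneq w 0; first by rewrite invr0 !mulr0.
by field; rewrite w0 x0 y0.
Qed.

Lemma radial_const_rec d N :
  (N%:R + 5 / 2 - u + d%:R) * radial_const d N.+1 = radial_const d N.
Proof.
have lt_u1 := u1; rewrite /radial_const -(natr1 N).
have nd : 0 < N%:R + 5 / 2 - u + d%:R.
  by have d0 : 0 <= d%:R :> R := ler0n _ _; have N0 : 0 <= N%:R :> R := ler0n _ _; lra.
rewrite (_ : N%:R + 1 + 5 / 2 - u + d%:R = N%:R + 5 / 2 - u + d%:R + 1); last by ring.
rewrite Gamma_rec //.
have g1 : Gamma (1 - u) != 0 by rewrite gt_eqF // Gamma_gt0; lra.
have g2 : Gamma (N%:R + 5 / 2 - u + d%:R) != 0 by rewrite gt_eqF // Gamma_gt0.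
have n0 : N%:R + 5 / 2 - u + d%:R != 0 by rewrite gt_eqF.
move: (Gamma (1 - u)) g1 (Gamma (N%:R + 5 / 2 - u + d%:R)) g2 => x x0 w w0.
move: (N%:R + 5 / 2 - u + d%:R) n0 => m m0.
by field; rewrite x0 w0 m0.
Qed.

End Moments.

(** * Mean of the powers of 1 + z *)

Section BinomialSums.
Variable F : numFieldType.
Implicit Type f : nat -> F.

Definition binomial_sum k f : F := \sum_(i < k.+1) 'C(k, i)%:R * f i.

Lemma binomial_sumS k f :
  binomial_sum k.+1 f = binomial_sum k f + binomial_sum k (fun i => f i.+1).
Proof.
rewrite /binomial_sum big_ord_recl [X in _ = X + _]big_ord_recl !bin0 -addrA.
congr (_ + _).
under eq_bigr => i _ do rewrite lift0 binS natrD mulrDl.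
rewrite big_split /=; congr (_ + _).
by rewrite big_ord_recr /= bin_small // mul0r addr0; apply: eq_bigr => i _.
Qed.

Lemma binomial_sum_mul k f :
  binomial_sum k.+1 (fun i => i%:R * f i) = k.+1%:R * binomial_sum k (fun i => f i.+1).
Proof.
rewrite /binomial_sum big_ord_recl mul0r mulr0 add0r mulr_sumr.
apply: eq_bigr => i _; rewrite lift0 mulrA.
have -> : 'C(k.+1, i.+1)%:R * i.+1%:R = k.+1%:R * 'C(k, i)%:R :> F.
  by rewrite -!natrM mulnC -mul_bin_diag.
by rewrite mulrA.
Qed.

Lemma binomial_sumB k f g :
  binomial_sum k (fun i => f i - g i) = binomial_sum k f - binomial_sum k g.
Proof. by rewrite /binomial_sum -sumrB; apply: eq_bigr => i _; rewrite mulrBr. Qed.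

Lemma binomial_sumZ k c f :
  binomial_sum k (fun i => c * f i) = c * binomial_sum k f.
Proof. by rewrite /binomial_sum mulr_sumr; apply: eq_bigr => i _; rewrite mulrCA. Qed.

Lemma eq_binomial_sum k f g : f =1 g -> binomial_sum k f = binomial_sum k g.
Proof. by move=> fg; apply: eq_bigr => i _; rewrite fg. Qed.

(* Integration by parts against the weight [(1 - z^2)^(c - 3/2)], with [mom] the
   moments of [z] and [binomial_sum k mom] the mean of [(1 + z)^k]. *)
Lemma binomial_sum_rec (mom : nat -> F) (c : F) k :
  (forall i, i%:R * mom i.-1 = (i%:R + 2 * c - 1) * mom i.+1) ->
  (k%:R + 2 * c - 1) * binomial_sum k.+1 mom =
  (2 * k%:R + 2 * c - 1) * binomial_sum k mom.
Proof.
move=> momE.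
have key : k%:R * (binomial_sum k mom - binomial_sum k (fun i => mom i.+1)) =
    (2 * c - 1) * binomial_sum k (fun i => mom i.+1).
  rewrite -binomial_sumZ.
  rewrite [RHS](eq_binomial_sum k (g := fun i => i%:R * (mom i.-1 - mom i.+1))); last first.
    by move=> i; rewrite mulrBr momE; ring.
  case: k => [|k]; first by rewrite mul0r /binomial_sum big_ord1 mul0r mulr0.
  rewrite (binomial_sum_mul k (fun i => mom i.-1 - mom i.+1)) binomial_sumB.
  by rewrite !binomial_sumS; ring.
rewrite binomial_sumS.
transitivity ((k%:R + 2 * c - 1) * binomial_sum k mom +
   k%:R * binomial_sum k (fun i => mom i.+1) +
   (2 * c - 1) * binomial_sum k (fun i => mom i.+1)); first by ring.
by rewrite -key; ring.
Qed.

End BinomialSums.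

Section AxisMean.
Variables (R : realType) (u : R) (d : nat).

(** The mean of z^i (1 - r^2)^d. *)
Definition axis_moment (i : nat) : R := gauss_moment R i * radial_const u d i./2.

Lemma axis_moment_rec i : u < 1 ->
  i%:R * axis_moment i.-1 = (i%:R + 2 * (5 / 2 - u + d%:R) - 1) * axis_moment i.+1.
Proof.
move=> u1; case: i => [|i].
  by rewrite /axis_moment /gauss_moment /= !mul0r mulr0.
rewrite /axis_moment gauss_moment_rec /= -(radial_const_rec u1).
have [oi|ei] := boolP (odd i); first by rewrite /gauss_moment oi !(mul0r, mulr0).
have -> : i.+1%:R = 2 * (i./2)%:R + 1 :> R.
  by rewrite -[in LHS](odd_double_half i) (negbTE ei) -natr1 -mul2n natrM.
by field.
Qed.

(** The mean of (1 + z)^k (1 - r^2)^d, which is lambda_d up to powers of 2 when k = n - 2d. *)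
Definition axis_mean (k : nat) : R :=
  Gamma (5 / 2 - u) * Gamma (1 - u + d%:R) / Gamma (1 - u) * Gamma (2 + k%:R + d%:R - u) /
  (Gamma (5 / 2 + k%:R / 2 + d%:R - u) * Gamma (2 + k%:R / 2 + d%:R - u)).

Lemma axis_meanE k : u < 1 -> binomial_sum k axis_moment = axis_mean k.
Proof.
move=> u1; have d0 : 0 <= d%:R :> R := ler0n _ _.
have nz t : 0 < t -> Gamma t != 0 :> R by move=> t0; rewrite gt_eqF // Gamma_gt0.
elim: k => [|k IH].
  have gm0 : gauss_moment R 0 = 1 by rewrite /gauss_moment /= expr0 mul1r divr1.
  rewrite /binomial_sum big_ord1 bin0 mul1r /axis_moment gm0 mul1r.
  rewrite /radial_const /axis_mean mul0r !addr0 add0r.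
  have g1 : Gamma (2 + d%:R - u) != 0 by apply: nz; lra.
  have -> : 5 / 2 - u + d%:R = 5 / 2 + d%:R - u by ring.
  rewrite -!mulrA; congr (_ * (_ * (_ * _))).
  by rewrite invfM mulrCA mulfV // mulr1.
have k0 : 0 <= k%:R :> R := ler0n _ _.
have := binomial_sum_rec k (fun i => axis_moment_rec i u1); rewrite IH.
set c := 5 / 2 - u + d%:R => E.
have c0 : k%:R + 2 * c - 1 != 0 by rewrite gt_eqF // /c; lra.
apply: (mulfI c0); rewrite E /axis_mean -(natr1 k).
have -> : 2 + (k%:R + 1) + d%:R - u = (2 + k%:R + d%:R - u) + 1 by ring.
(* Raising k by one exchanges the two Gamma values of the denominator, one of them with its argument
   raised by 1; so a single use of the functional equation there suffices and no duplication formula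
   is needed. *)
have -> : 5 / 2 + (k%:R + 1) / 2 + d%:R - u = (2 + k%:R / 2 + d%:R - u) + 1 by field.
have -> : 2 + (k%:R + 1) / 2 + d%:R - u = 5 / 2 + k%:R / 2 + d%:R - u by field.
rewrite (Gamma_rec (s := 2 + k%:R + d%:R - u)); last lra.
rewrite (Gamma_rec (s := 2 + k%:R / 2 + d%:R - u)); last lra.
have h0 : 2 + k%:R / 2 + d%:R - u != 0 by rewrite gt_eqF //; lra.
have -> : k%:R + 2 * c - 1 = 2 * (2 + k%:R / 2 + d%:R - u) by rewrite /c; field.
have -> : 2 * k%:R + 2 * c - 1 = 2 * (2 + k%:R + d%:R - u) by rewrite /c; field.
have g1 : Gamma (2 + k%:R / 2 + d%:R - u) != 0 by apply: nz; lra.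
have g2 : Gamma (5 / 2 + k%:R / 2 + d%:R - u) != 0 by apply: nz; lra.
have g3 : Gamma (1 - u) != 0 by apply: nz; lra.
move: (Gamma (2 + k%:R / 2 + d%:R - u)) g1 (Gamma (5 / 2 + k%:R / 2 + d%:R - u)) g2.
move=> x x0 y y0; move: (Gamma (1 - u)) g3 => z z0.
move: (Gamma _) (Gamma _) (Gamma _) => v1 v2 v3.
move: (2 + k%:R / 2 + d%:R - u) h0 => h h0.
by field; rewrite ?x0 ?y0 ?z0 ?h0.
Qed.

End AxisMean.

(** * Means of complex-valued functions and of powers of affine forms *)

Section ComplexMean.
Local Open Scope complex_scope.
Variable R : realType.
Local Notation C := R[i].
Local Notation mR := (measurableTypeR R).
Local Notation mR3 := (mR * mR * mR)%type.
Implicit Types (f g : mR3 -> C) (u : R).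

Definition ball_boundedC f : Prop :=
  ball_bounded (fun p => complex.Re (f p)) /\ ball_bounded (fun p => complex.Im (f p)).

Definition ball_meanC u f : C :=
  (ball_mean u (fun p => complex.Re (f p))) +i* (ball_mean u (fun p => complex.Im (f p))).

Lemma ReD (a b : C) : complex.Re (a + b) = complex.Re a + complex.Re b.
Proof. by case: a b => [? ?] []. Qed.

Lemma ImD (a b : C) : complex.Im (a + b) = complex.Im a + complex.Im b.
Proof. by case: a b => [? ?] []. Qed.

Lemma ReM (a b : C) : complex.Re (a * b) =
  complex.Re a * complex.Re b + -1 * (complex.Im a * complex.Im b).
Proof. by case: a b => [? ?] [? ?] /=; rewrite mulN1r. Qed.

Lemma ImM (a b : C) : complex.Im (a * b) =
  complex.Re a * complex.Im b + complex.Im a * complex.Re b.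
Proof. by case: a b => [? ?] [? ?] /=. Qed.

Lemma ball_boundedC_cst c : ball_boundedC (fun=> c).
Proof. by split; exact: ball_bounded_cst. Qed.

Lemma ball_boundedC_real (h : mR3 -> R) : ball_bounded h ->
  ball_boundedC (fun p => (h p)%:C).
Proof. by move=> bh; split => //; exact: ball_bounded_cst. Qed.

Lemma ball_boundedCD f g : ball_boundedC f -> ball_boundedC g ->
  ball_boundedC (fun p => f p + g p).
Proof.
move=> [fr fi] [gr gi]; split.
  by under eq_fun do rewrite ReD; exact: ball_boundedD.
by under eq_fun do rewrite ImD; exact: ball_boundedD.
Qed.

Lemma ball_boundedCM f g : ball_boundedC f -> ball_boundedC g ->
  ball_boundedC (fun p => f p * g p).
Proof.
move=> [fr fi] [gr gi]; split.
  under eq_fun do rewrite ReM; apply: ball_boundedD; first exact: ball_boundedM.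
  by apply: ball_boundedM; [exact: ball_bounded_cst|exact: ball_boundedM].
under eq_fun do rewrite ImM; apply: ball_boundedD; exact: ball_boundedM.
Qed.

Lemma ball_boundedCX f n : ball_boundedC f -> ball_boundedC (fun p => f p ^+ n).
Proof.
move=> bf; elim: n => [|n IH]; first exact: ball_boundedC_cst.
by under eq_fun do rewrite exprS; exact: ball_boundedCM.
Qed.

Lemma ball_boundedC_sum n (F : 'I_n -> mR3 -> C) :
  (forall i, ball_boundedC (F i)) -> ball_boundedC (fun p => \sum_i F i p).
Proof.
move=> bF; elim: n F bF => [|n IH] F bF.
  by under eq_fun do rewrite big_ord0; exact: ball_boundedC_cst.
under eq_fun do rewrite big_ord_recl.
by apply: ball_boundedCD => //; apply: IH => i.
Qed.

Lemma ball_meanC_real u (h : mR3 -> R) :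
  ball_meanC u (fun p => (h p)%:C) = (ball_mean u h)%:C.
Proof.
rewrite /ball_meanC /=; congr (_ +i* _).
rewrite /ball_mean /Rintegral integral0_eq // => p _.
by rewrite mulr0.
Qed.

Section Linear.
Variable u : R.
Hypothesis u1 : u < 1.

Lemma ball_meanCD f g : ball_boundedC f -> ball_boundedC g ->
  ball_meanC u (fun p => f p + g p) = ball_meanC u f + ball_meanC u g.
Proof.
move=> [fr fi] [gr gi]; rewrite /ball_meanC.
rewrite -[RHS]/((_ + _) +i* (_ + _)) -!(ball_meanD u1) //.
by congr (_ +i* _); congr ball_mean; apply/funext => p; rewrite ?ReD ?ImD.
Qed.

Lemma ball_meanCZ c f : ball_boundedC f ->
  ball_meanC u (fun p => c * f p) = c * ball_meanC u f.
Proof.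
move=> [fr fi]; rewrite /ball_meanC; case: c => a b.
have bz (e : R) h : ball_bounded h -> ball_bounded (fun p : mR3 => e * h p).
  by move=> bh; apply: ball_boundedM => //; exact: ball_bounded_cst.
rewrite -[RHS]/((_ - _) +i* (_ + _)) -!(ball_meanZ u1) //.
rewrite -mulN1r -(ball_meanZ u1) -?(ball_meanD u1); try do ?[exact: bz | apply: (bz)].
by congr (_ +i* _); congr ball_mean; apply/funext => p; rewrite ?ReM ?ImM.
Qed.

Lemma ball_meanC_sum n (F : 'I_n -> mR3 -> C) : (forall i, ball_boundedC (F i)) ->
  ball_meanC u (fun p => \sum_i F i p) = \sum_i ball_meanC u (F i).
Proof.
elim: n F => [|n IH] F bF.
  rewrite big_ord0; under eq_fun do rewrite big_ord0.
  have := @ball_meanCZ 0 (fun=> 0) (ball_boundedC_cst 0).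
  by rewrite [RHS]mul0r => {2}<-; congr ball_meanC; apply/funext => p; rewrite mul0r.
rewrite big_ord_recl; under eq_fun do rewrite big_ord_recl.
rewrite ball_meanCD //; last exact: ball_boundedC_sum.
by rewrite IH.
Qed.

Lemma gauss_moment_real j : gauss_moment C j = (gauss_moment R j)%:C.
Proof.
rewrite /gauss_moment; case: ifP => _; first by rewrite rmorph0.
by rewrite fmorph_div rmorphM rmorphXn !rmorph_nat.
Qed.

Lemma ball_meanC_monomial (c : C) (a b e d : nat) :
  ball_meanC u (fun p => c * (monomial a b e p * one_sub_r2 p ^+ d)%:C) =
  c * (gauss_moment C a * gauss_moment C b * gauss_moment C e *
       (radial_const u d (a + b + e)./2)%:C).
Proof.
have bm : ball_bounded (fun p : mR3 => monomial a b e p * one_sub_r2 p ^+ d).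
  by apply: ball_boundedM; [exact: ball_bounded_monomial|exact: ball_bounded_r2].
rewrite ball_meanCZ; last exact: ball_boundedC_real.
rewrite ball_meanC_real (ball_mean_monomial u1).
by rewrite !gauss_moment_real !rmorphM.
Qed.

(** Odd moments vanish, so w enters only through its square, for complex w as well. *)
Lemma gauss_moment_sqr (w : C) m : gauss_moment C m * w ^+ m =
  gauss_moment C m * (w ^+ 2) ^+ m./2.
Proof.
have [om|em] := boolP (odd m); first by rewrite /gauss_moment om !mul0r.
by rewrite -exprM -{2}[m]odd_double_half (negbTE em) mul2n.
Qed.

(** Algebraic rotation invariance: among the monomials of total degree j, Gaussian convolution
    collects the squares of the coefficients into w.w = c0^2, as if the form were c0 (1 + z). *)
Lemma ball_meanC_linear_form (c0 w1 w2 w3 : C) (d k : nat) :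
  w1 ^+ 2 + w2 ^+ 2 + w3 ^+ 2 = c0 ^+ 2 ->
  ball_meanC u (fun p => (c0 + (w1 * (p.1.1)%:C + (w2 * (p.1.2)%:C + w3 * (p.2)%:C))) ^+ k
     * (one_sub_r2 p ^+ d)%:C) = c0 ^+ k * (axis_mean u d k)%:C.
Proof.
move=> wE.
pose coef (j i l : nat) : C := 'C(k, j)%:R * c0 ^+ (k - j) *
  ('C(j, i)%:R * w1 ^+ (j - i) * ('C(i, l)%:R * (w2 ^+ (i - l) * w3 ^+ l))).
pose term (j i l : nat) (p : mR3) : C :=
  coef j i l * (monomial (j - i) (i - l) l p * one_sub_r2 p ^+ d)%:C.
have bt j i l : ball_boundedC (term j i l).
  apply: ball_boundedCM; first exact: ball_boundedC_cst.
  apply: ball_boundedC_real.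
  by apply: ball_boundedM; [exact: ball_bounded_monomial|exact: ball_bounded_r2].
transitivity (ball_meanC u (fun p =>
    \sum_(j < k.+1) \sum_(i < j.+1) \sum_(l < i.+1) term j i l p)).
  congr ball_meanC; apply/funext => p; rewrite exprDn mulr_suml.
  apply: eq_bigr => j _; rewrite exprDn mulr_sumr -mulr_natl !mulr_sumr mulr_suml.
  apply: eq_bigr => i _; rewrite exprDn mulr_sumr -[(\sum_(_ < _) _) *+ _]mulr_natl.
  rewrite !mulr_sumr mulr_suml.
  apply: eq_bigr => l _; rewrite -mulr_natl /term /coef /monomial.
  by rewrite !rmorphM !rmorphXn !exprMn; ring.
rewrite ball_meanC_sum; last by move=> j; do 2!apply: ball_boundedC_sum => ?.
transitivity (\sum_(j < k.+1) 'C(k, j)%:R * c0 ^+ (k - j) *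
    (gauss_moment C j * c0 ^+ j * (radial_const u d j./2)%:C)).
  apply: eq_bigr => j _.
  rewrite ball_meanC_sum; last by move=> i; apply: ball_boundedC_sum => ?.
  (* Convolution is run backwards: first w1^2 is separated from w2^2 + w3^2, then w2^2 from w3^2. *)
  rewrite gauss_moment_sqr -wE -addrA -gauss_moment_conv mulr_suml mulr_sumr.
  apply: eq_bigr => i _; rewrite ball_meanC_sum //.
  rewrite -gauss_moment_conv !mulr_sumr !mulr_suml !mulr_sumr.
  apply: eq_bigr => l _; rewrite /term ball_meanC_monomial.
  have -> : (j - i + (i - l) + l)%N = j.
    by have := ltn_ord i; have := ltn_ord l; rewrite !ltnS; lia.
  rewrite -[in RHS]gauss_moment_sqr -[in RHS]gauss_moment_sqr -[in RHS]gauss_moment_sqr.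
  by rewrite /coef; ring.
rewrite -axis_meanE // /binomial_sum rmorph_sum mulr_sumr.
apply: eq_bigr => -[j jk] _ /=; rewrite ltnS in jk.
have -> : c0 ^+ k = c0 ^+ (k - j) * c0 ^+ j by rewrite -exprD subnK.
rewrite gauss_moment_real /axis_moment !rmorphM /=.
rewrite -[in LHS](rmorph_nat (real_complex R)).
by ring.
Qed.

End Linear.

End ComplexMean.

(** * Eigenvalues of zeta *)

Section BilinearForms.
Variable F : numFieldType.

(** In characteristic 0 the naturals below [size p] are more roots than a nonzero [p] can have. *)
Lemma poly_fun0 (p : {poly F}) : (forall x, p.[x] = 0) -> p = 0.
Proof.
move=> p0; apply/eqP; apply: contraT => pN0.
pose rs := [seq i%:R : F | i <- iota 0 (size p)].
have := @max_poly_roots _ p rs pN0.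
rewrite size_map size_iota ltnn; apply.
  by apply/allP => x _; apply/rootP; exact: p0.
rewrite map_inj_uniq ?iota_uniq // => i j /eqP; rewrite eqr_nat => /eqP //.
Qed.

Lemma bilinear_form0 k (Y : 'M[F]_k.+1) :
  (forall a b : F, \sum_(m < k.+1) \sum_(l < k.+1) a ^+ m * b ^+ l * Y m l = 0) -> Y = 0.
Proof.
move=> Y0.
have Yb (b : F) m : \sum_(l < k.+1) b ^+ l * Y m l = 0.
  pose p : {poly F} := \poly_(i < k.+1) \sum_(l < k.+1) b ^+ l * Y (inord i) l.
  have p0 : p = 0.
    apply: poly_fun0 => a; rewrite horner_poly -[RHS](Y0 a b).
    apply: eq_bigr => i _; rewrite inord_val mulr_suml; apply: eq_bigr => l _.
    by ring.
  have : p`_m = 0 by rewrite p0 coef0.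
  by rewrite coef_poly ltn_ord inord_val.
apply/matrixP => m l; rewrite mxE.
pose p : {poly F} := \poly_(i < k.+1) Y m (inord i).
have p0 : p = 0.
  apply: poly_fun0 => b; rewrite horner_poly -[RHS](Yb b m).
  by apply: eq_bigr => i _; rewrite inord_val mulrC.
have : p`_l = 0 by rewrite p0 coef0.
by rewrite coef_poly ltn_ord inord_val.
Qed.

(** The binomial weights turn the sum over rows into the expansion of a k-th power: Sym^k M on (1,
    a, a^2, ...) and (1, b, b^2, ...) is the k-th power of M on (1, a) and (1, b). *)
Lemma sympow_form k (M : 'M[F]_2) a b :
  \sum_(m < k.+1) \sum_(l < k.+1) 'C(k, m)%:R * a ^+ m * b ^+ l * sympow k M m l =
  (M 0 0 + M 0 1 * b + a * (M 1 0 + M 1 1 * b)) ^+ k.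
Proof.
have rowE i : (row_poly M i).[b] = M i 0 + M i 1 * b.
  by rewrite /row_poly hornerD hornerC hornerZ hornerX.
rewrite exprDn; apply: eq_bigr => m _.
transitivity ('C(k, m)%:R * a ^+ m * (sympow_poly k M m).[b]).
  have mk : (m <= k)%N by rewrite -ltnS.
  rewrite (horner_coef_wide _ (size_sympow_poly M mk)).
  by rewrite mulr_sumr; apply: eq_bigr => l _; rewrite mxE; ring.
rewrite /sympow_poly hornerM !horner_exp !rowE exprMn -[RHS]mulr_natl; ring.
Qed.

End BilinearForms.

Section Zeta.
Local Open Scope complex_scope.
Variables (R : realType) (u : R).
Hypothesis u1 : u < 1.
Local Notation C := R[i].
Local Notation mR := (measurableTypeR R).
Local Notation mR3 := (mR * mR * mR)%type.

Definition bloch (p : mR3) : 'M[C]_2 := bloch_state (p.1.1 : R) p.1.2 p.2.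

Lemma blochE (p : mR3) : [/\ bloch p 0 0 = 2^-1 * (1 + p.2%:C),
   bloch p 0 1 = 2^-1 * (p.1.1%:C - 'i * p.1.2%:C),
   bloch p 1 0 = 2^-1 * (p.1.1%:C + 'i * p.1.2%:C) &
   bloch p 1 1 = 2^-1 * (1 - p.2%:C)].
Proof.
rewrite /bloch /bloch_state; split; rewrite !mxE /=; congr (_ * _);
  by apply/eqP; rewrite eq_complex /=; rewrite !(mul0r, mul1r, addr0, add0r, subr0, sub0r, mulr0, oppr0) !eqxx.
Qed.

Lemma ball_boundedC_ext (f g : mR3 -> C) :
  (forall p, f p = g p) -> ball_boundedC g -> ball_boundedC f.
Proof. by move=> /funext ->. Qed.

Lemma bloch_bounded i j : ball_boundedC (fun p => bloch p i j).
Proof.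
have [bx by_ bz] := @ball_bounded_coords R.
have cB := @ball_boundedC_cst R.
have rx := ball_boundedC_real bx; have ry := ball_boundedC_real by_.
have rz := ball_boundedC_real bz.
have scaleB (c : C) (h : mR3 -> C) : ball_boundedC h -> ball_boundedC (fun p => c * h p).
  by move=> bh; exact: ball_boundedCM (cB c) bh.
case: (ord2P i) => ->; case: (ord2P j) => ->.
- apply: (@ball_boundedC_ext _ (fun p => 2^-1 * (1 + p.2%:C))).
    by move=> p; have [] := blochE p.
  exact: (scaleB _ _ (ball_boundedCD (cB 1) rz)).
- apply: (@ball_boundedC_ext _ (fun p => 2^-1 * (p.1.1%:C + (- 'i) * p.1.2%:C))).
    by move=> p; have [_ -> _ _] := blochE p; rewrite mulNr.
  exact: (scaleB _ _ (ball_boundedCD rx (scaleB _ _ ry))).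
- apply: (@ball_boundedC_ext _ (fun p => 2^-1 * (p.1.1%:C + 'i * p.1.2%:C))).
    by move=> p; have [] := blochE p.
  exact: (scaleB _ _ (ball_boundedCD rx (scaleB _ _ ry))).
- apply: (@ball_boundedC_ext _ (fun p => 2^-1 * (1 + (-1) * p.2%:C))).
    by move=> p; have [_ _ _ ->] := blochE p; rewrite mulN1r.
  exact: (scaleB _ _ (ball_boundedCD (cB 1) (scaleB _ _ rz))).
Qed.

Lemma ntensmx_bounded n i j : ball_boundedC (fun p => ntensmx (bloch p) n.+1 i j).
Proof.
elim: n i j => [|n IH] i j; first exact: bloch_bounded.
apply: (@ball_boundedC_ext _ (fun p =>
   bloch p (@mxtens_unindex 2 (2 ^ n.+1) i).1 (@mxtens_unindex 2 (2 ^ n.+1) j).1 *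
   ntensmx (bloch p) n.+1 (@mxtens_unindex 2 (2 ^ n.+1) i).2 (@mxtens_unindex 2 (2 ^ n.+1) j).2)).
  by move=> p; rewrite ntensmxSS mxE.
by apply: ball_boundedCM; [exact: bloch_bounded|exact: IH].
Qed.

Lemma det_bloch p : \det (bloch p) = 4^-1 * (one_sub_r2 p)%:C.
Proof.
have [b00 b01 b10 b11] := blochE p; rewrite det_mx2E b00 b01 b10 b11.
have i2 : 'i ^+ 2 = -1 :> C by exact: sqr_i.
rewrite /one_sub_r2 !rmorphB !rmorphXn rmorph1.
transitivity (4^-1 * (1 - (p.1.1)%:C ^+ 2 + 'i ^+ 2 * (p.1.2)%:C ^+ 2 - (p.2)%:C ^+ 2) : C).
  by field.
by rewrite i2; congr (_ * _); ring.
Qed.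

Lemma Re_realM (q : R) (c : C) : complex.Re (q%:C * c) = q * complex.Re c.
Proof. by case: c => a b /=; rewrite mul0r subr0. Qed.

Lemma Im_realM (q : R) (c : C) : complex.Im (q%:C * c) = q * complex.Im c.
Proof. by case: c => a b /=; rewrite mul0r addr0. Qed.

Lemma zetaE n i j : zeta n u i j = ball_meanC u (fun p => ntensmx (bloch p) n i j).
Proof.
have ballE (p : mR3) : @unit_ball3 R p <-> 0 <= one_sub_r2 p.
  rewrite /unit_ball3 /one_sub_r2 /=; split; lra.
have densE (h : mR3 -> R) :
    \int[(@lebesgue_measure R \x @lebesgue_measure R \x @lebesgue_measure R)%E]_(p in
       @unit_ball3 R) (prior_density u p.1.1 p.1.2 p.2 * h p) = ball_mean u h.
  rewrite Rintegral_mkcond; apply: eq_Rintegral => p _; rewrite patchE.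
  case: ifPn => pb.
    have {}pb : 0 <= one_sub_r2 p by apply/ballE; rewrite inE in pb.
    rewrite /prior_density /ball_dens /ball_kernel pb /one_sub_r2; congr (_ * _).
    by rewrite !invfM !mulrA.
  rewrite ball_dens_out ?mul0r // ltNge; apply/negP => /ballE pb'.
  by move/negP: pb; apply; rewrite inE.
rewrite /zeta /mx_integral mxE /ball_meanC; congr (_ +i* _).
  rewrite -densE; apply: eq_Rintegral => p _; rewrite mxE; exact: Re_realM.
rewrite -densE; apply: eq_Rintegral => p _; rewrite mxE; exact: Im_realM.
Qed.

(** Each of the k factors of the form contributes the 1/2 of the state, each determinant a 1/4. *)
Definition block_eigenvalue (d k : nat) : R := 2^-1 ^+ k * 4^-1 ^+ d * axis_mean u d k.

Lemma ball_boundedCZ (c : C) (h : mR3 -> C) :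
  ball_boundedC h -> ball_boundedC (fun p => c * h p).
Proof. by move=> bh; exact: ball_boundedCM (ball_boundedC_cst c) bh. Qed.

Lemma sympow_bounded k m l : ball_boundedC (fun p => sympow k (bloch p) m l).
Proof.
have step a (q : mR3 -> {poly C}) : (forall j, ball_boundedC (fun p => (q p)`_j)) ->
    forall j, ball_boundedC (fun p => (row_poly (bloch p) a * q p)`_j).
  move=> bq [|j]; first apply: (@ball_boundedC_ext _
      (fun p => bloch p a 0 * (q p)`_0 + bloch p a 1 * 0)).
  - by move=> p; rewrite coef_row_polyM.
  - by apply: ball_boundedCD; apply: ball_boundedCM => //;
      [exact: bloch_bounded|exact: bloch_bounded|exact: ball_boundedC_cst].
  apply: (@ball_boundedC_ext _
      (fun p => bloch p a 0 * (q p)`_j.+1 + bloch p a 1 * (q p)`_j)).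
    by move=> p; rewrite coef_row_polyM.
  by apply: ball_boundedCD; apply: ball_boundedCM => //; exact: bloch_bounded.
have pows e f : forall j, ball_boundedC (fun p =>
    (row_poly (bloch p) 0 ^+ e * row_poly (bloch p) 1 ^+ f)`_j).
  elim: e => [|e IH]; last first.
    move=> j; apply: (ball_boundedC_ext _ (step 0 _ IH j)) => p.
    by rewrite exprS mulrA.
  elim: f => [|f IH] j; last first.
    apply: (ball_boundedC_ext _ (step 1 _ IH j)) => p.
    by rewrite !expr0 !mul1r exprS.
  apply: (@ball_boundedC_ext _ (fun=> (j == 0)%:R)); last exact: ball_boundedC_cst.
  by move=> p; rewrite !expr0 mulr1 coef1.
by apply: (ball_boundedC_ext _ (pows (k - m)%N m l)) => p; rewrite mxE.
Qed.

Lemma det_sympow_bounded d k m l :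
  ball_boundedC (fun p => \det (bloch p) ^+ d * sympow k (bloch p) m l).
Proof.
apply: ball_boundedCM; last exact: sympow_bounded.
apply: ball_boundedCX; apply: (ball_boundedC_ext (fun p => det_bloch p)).
apply: ball_boundedCZ; apply: ball_boundedC_real.
exact: (@ball_bounded_r2 R 1).
Qed.

(** A direct substitute for Schur's lemma: the averaged matrix and the scalar one agree as bilinear
    forms on all vectors (1, a, a^2, ...) and (1, b, b^2, ...). *)
Lemma mean_sympow d k m l :
  ball_meanC u (fun p => \det (bloch p) ^+ d * sympow k (bloch p) m l) =
  (block_eigenvalue d k)%:C * (m == l)%:R.
Proof.
pose X (i j : 'I_k.+1) :=
  ball_meanC u (fun p => \det (bloch p) ^+ d * sympow k (bloch p) i j).
(* The binomial weights are those of [sympow_form]; being nonzero, they can be divided out of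
   [Y = 0]. *)
pose Y : 'M[C]_k.+1 := \matrix_(i, j)
  ('C(k, i)%:R * (X i j - (block_eigenvalue d k)%:C * (i == j)%:R)).
suff Y0 : Y = 0.
  have : Y m l = 0 by rewrite Y0 mxE.
  rewrite mxE => /eqP; rewrite mulf_eq0 pnatr_eq0 -leqn0 leqNgt bin_gt0 -ltnS ltn_ord /=.
  by rewrite subr_eq0 => /eqP.
apply: bilinear_form0 => a b.
have meanE : \sum_(i < k.+1) \sum_(j < k.+1) 'C(k, i)%:R * a ^+ i * b ^+ j * X i j =
    (block_eigenvalue d k)%:C * (1 + a * b) ^+ k.
  have bS i j (c : C) : ball_boundedC (fun p => c * (\det (bloch p) ^+ d * sympow k (bloch p) i j)).
    by apply: ball_boundedCZ; exact: det_sympow_bounded.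
  transitivity (ball_meanC u (fun p => \sum_(i < k.+1) \sum_(j < k.+1)
     'C(k, i)%:R * a ^+ i * b ^+ j * (\det (bloch p) ^+ d * sympow k (bloch p) i j))).
    rewrite ball_meanC_sum //; last by move=> i; apply: ball_boundedC_sum => j.
    apply: eq_bigr => i _; rewrite ball_meanC_sum //; apply: eq_bigr => j _.
    by rewrite ball_meanCZ //; exact: det_sympow_bounded.
  have i2 : 'i ^+ 2 = -1 :> C by exact: sqr_i.
  (* Twice the value of the state on (1, a) and (1, b) is 1 + ab + w.p with w = (a + b, i(a - b), 1
     - ab). *)
  have ww : (a + b) ^+ 2 + ('i * (a - b)) ^+ 2 + (1 - a * b) ^+ 2 = (1 + a * b) ^+ 2.
    by rewrite exprMn i2; ring.
  have := ball_meanC_linear_form u1 d k ww.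
  set f := (fun p : mR3 => _) => fE.
  transitivity (ball_meanC u (fun p => (2^-1 ^+ k * 4^-1 ^+ d) * f p)).
    congr ball_meanC; apply/funext => p.
    transitivity (\det (bloch p) ^+ d * (\sum_(i < k.+1) \sum_(j < k.+1)
        'C(k, i)%:R * a ^+ i * b ^+ j * sympow k (bloch p) i j)).
      rewrite mulr_sumr; apply: eq_bigr => i _; rewrite mulr_sumr.
      by apply: eq_bigr => j _; ring.
    have [b00 b01 b10 b11] := blochE p.
    rewrite sympow_form det_bloch b00 b01 b10 b11 /f exprMn rmorphXn.
    have -> : 2^-1 * (1 + (p.2)%:C) + 2^-1 * ((p.1.1)%:C - 'i * (p.1.2)%:C) * b +
        a * (2^-1 * ((p.1.1)%:C + 'i * (p.1.2)%:C) + 2^-1 * (1 - (p.2)%:C) * b) =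
      2^-1 * (1 + a * b + ((a + b) * (p.1.1)%:C +
         ('i * (a - b) * (p.1.2)%:C + (1 - a * b) * (p.2)%:C))) by ring.
    by rewrite exprMn; ring.
  rewrite ball_meanCZ ?fE //; last first.
    rewrite /f; apply: ball_boundedCM; last first.
      by apply: ball_boundedC_real; exact: ball_bounded_r2.
    have [bx by_ bz] := @ball_bounded_coords R.
    have rx := ball_boundedC_real bx; have ry := ball_boundedC_real by_.
    have rz := ball_boundedC_real bz.
    apply: ball_boundedCX; apply: ball_boundedCD; first exact: ball_boundedC_cst.
    apply: ball_boundedCD; first exact: ball_boundedCZ.
    by apply: ball_boundedCD; exact: ball_boundedCZ.
  rewrite /block_eigenvalue !rmorphM !rmorphXn !fmorphV !rmorph_nat.
  by ring.
transitivity (\sum_(i < k.+1) \sum_(j < k.+1) 'C(k, i)%:R * a ^+ i * b ^+ j * X i j -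
   (block_eigenvalue d k)%:C * \sum_(i < k.+1) 'C(k, i)%:R * (a * b) ^+ i).
  rewrite mulr_sumr -sumrB; apply: eq_bigr => i _.
  rewrite [in RHS](bigD1 i) //= [in LHS](bigD1 i) //= !mxE eqxx.
  have -> : \sum_(j < k.+1 | j != i) a ^+ i * b ^+ j * Y i j =
     \sum_(j < k.+1 | j != i) 'C(k, i)%:R * a ^+ i * b ^+ j * X i j.
    apply: eq_bigr => j /negbTE ji; rewrite mxE eq_sym ji mulr0 subr0; ring.
  by rewrite exprMn mulr1; ring.
rewrite meanE exprDn (eq_bigr (fun i : 'I_k.+1 => 'C(k, i)%:R * (a * b) ^+ i)) ?subrr //.
by move=> i _; rewrite expr1n mul1r mulr_natl.
Qed.

(** [block_in] is constant in the integration variable, so its relation with the tensor power passes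
    through the mean, where Sym^k becomes a scalar. *)
Lemma zeta_block n (c : block C (2 ^ n.+1)) : valid_block c ->
  zeta n.+1 u *m block_in c =
  (block_eigenvalue (block_deg c) (block_ord c))%:C *: block_in c.
Proof.
case: c => d k U T [/= _ _ HU]; apply/matrixP => i l; rewrite !mxE.
transitivity (ball_meanC u (fun p => \sum_j U j l * ntensmx (bloch p) n.+1 i j)).
  rewrite ball_meanC_sum //; last by move=> j; apply: ball_boundedCZ; exact: ntensmx_bounded.
  apply: eq_bigr => j _; rewrite zetaE ball_meanCZ //; last exact: ntensmx_bounded.
  exact: mulrC.
transitivity (ball_meanC u (fun p => \sum_m U i m *
     (\det (bloch p) ^+ d * sympow k (bloch p) m l))).
  congr ball_meanC; apply/funext => p.
  transitivity ((ntensmx (bloch p) n.+1 *m U) i l).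
    by rewrite mxE; apply: eq_bigr => j _; rewrite mulrC.
  rewrite HU !mxE mulr_sumr; apply: eq_bigr => m _; ring.
rewrite ball_meanC_sum //; last by move=> m; apply: ball_boundedCZ; exact: det_sympow_bounded.
rewrite (bigD1 l) //= big1 => [|m /negbTE ml].
  rewrite ball_meanCZ //; last exact: det_sympow_bounded.
  by rewrite mean_sympow eqxx mulr1 addr0 mulrC.
rewrite ball_meanCZ //; last exact: det_sympow_bounded.
by rewrite mean_sympow ml !mulr0.
Qed.

End Zeta.

(** * The closed formula and its limit at r = 0 *)

Section Formula.
Variable R : realType.
Implicit Types (n d : nat) (u r t : R).
Local Open Scope complex_scope.

Lemma zeta_eigenvalueE n u d : (d + d <= n)%N ->
  zeta_eigenvalue n u d = block_eigenvalue u d (n - d - d).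
Proof.
move=> dn; rewrite /zeta_eigenvalue /block_eigenvalue /axis_mean.
have nE : n%:R = (n - d - d)%:R + 2 * d%:R :> R.
  by rewrite -natrM -natrD; congr _%:R; lia.
have -> : 2 ^+ n = 2 ^+ (n - d - d) * 4 ^+ d :> R.
  have -> : (4 : R) = 2 ^+ 2 by rewrite expr2; ring.
  by rewrite -exprM -exprD; congr (_ ^+ _); lia.
rewrite nE !exprVn invfM.
have -> : 2 + ((n - d - d)%:R + 2 * d%:R) - d%:R - u = 2 + (n - d - d)%:R + d%:R - u :> R.
  by ring.
have -> : 5 / 2 + ((n - d - d)%:R + 2 * d%:R) / 2 - u =
   5 / 2 + (n - d - d)%:R / 2 + d%:R - u :> R by field.
have -> : 2 + ((n - d - d)%:R + 2 * d%:R) / 2 - u =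
   2 + (n - d - d)%:R / 2 + d%:R - u :> R by field.
have -> : 1 + d%:R - u = 1 - u + d%:R :> R by ring.
move: (Gamma _) (Gamma _) (Gamma _) (Gamma _) (Gamma _) (Gamma _) => g1 g2 g3 g4 g5 g6.
by rewrite !invfM; ring.
Qed.

Lemma zeta_eigenvalue_gt0 n u d : u < 1 -> (d + d <= n)%N -> 0 < zeta_eigenvalue n u d.
Proof.
move=> u1 dn; have d0 : 0 <= d%:R :> R := ler0n _ _.
have nd : d%:R + d%:R <= n%:R :> R by rewrite -natrD ler_nat.
have n0 : 0 <= n%:R :> R := ler0n _ _.
rewrite /zeta_eigenvalue.
have g (s : R) : 0 < s -> 0 < Gamma s by exact: Gamma_gt0.
apply: mulr_gt0; first by rewrite divr_gt0 ?exprn_gt0.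
apply: divr_gt0; apply: mulr_gt0; try apply: mulr_gt0; apply: g; lra.
Qed.

(* Unlike [entropy_formula], meaningful at [r = 0]. *)
Definition entropy_sum n u r : R :=
  let a := (1 + r) / 2 in let b := (1 - r) / 2 in
  n%:R * (a * ln a + b * ln b) -
  \sum_(0 <= d < n./2.+1) ballot R n d *
     ((a * b) ^+ d * \sum_(i < (n - d - d).+1) a ^+ (n - d - d - i) * b ^+ i) *
     ln (zeta_eigenvalue n u d).

Lemma entropy_formulaE n u r : r != 0 -> entropy_formula n u r = entropy_sum n u r.
Proof.
move=> r0; rewrite /entropy_formula /entropy_sum.
set a := (1 + r) / 2; set b := (1 - r) / 2; congr (_ - _).
  by rewrite /a /b; field.
apply: eq_big_nat => d dn; have {}dn : (d + d <= n)%N by lia.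
congr (_ * _); rewrite ballotE // -mulrA; congr (_ * _).
have aE : 1 + r = 2 * a by rewrite /a; field.
have bE : 1 - r = 2 * b by rewrite /b; field.
have rE : r = a - b by rewrite /a /b; field.
have ab0 : a - b != 0 by rewrite -rE.
clearbody a b; set k := (n - d - d)%N.
have -> : (n - d + 1 = k.+1 + d)%N by rewrite /k; lia.
have -> : (n + 1 = k.+1 + d + d)%N by rewrite /k; lia.
have diffE : a ^+ k.+1 - b ^+ k.+1 = r * \sum_(i < k.+1) a ^+ (k - i) * b ^+ i.
  by rewrite rE subrXX.
have two0 m : (2 : R) ^+ m != 0 by rewrite expf_neq0 // pnatr_eq0.
(* Since r = a - b, the quotient is a geometric sum; the k+1+2d factors 2 coming from 1 + r = 2a and
   1 - r = 2b cancel 2^(n+1). *)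
transitivity (a ^+ d * b ^+ d * ((a ^+ k.+1 - b ^+ k.+1) / r)); last first.
  by rewrite diffE [r * _]mulrC mulfK // exprMn.
rewrite aE bE !exprMn !exprD.
move: (2 ^+ k.+1) (two0 k.+1) (2 ^+ d) (two0 d) => x x0 y y0.
move: (a ^+ k.+1) (b ^+ k.+1) => a' b'.
by field; rewrite ?x0 ?y0 ?r0.
Qed.

Definition right_continuous0 (h : R -> R) := h t @[t --> (0 : R)^'+] --> h 0.

Lemma right_continuous0_sum (I : Type) (s : seq I) (f : I -> R -> R) :
  (forall i, right_continuous0 (f i)) ->
  right_continuous0 (fun t => \sum_(i <- s) f i t).
Proof.
move=> fc; rewrite /right_continuous0; elim: s => [|i s IH].
  by rewrite big_nil; under eq_fun do rewrite big_nil; exact: cvg_cst.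
rewrite big_cons; under eq_fun do rewrite big_cons.
by apply: cvgD => //; exact: fc.
Qed.

Lemma right_continuous0X (f : R -> R) m :
  right_continuous0 f -> right_continuous0 (fun t => f t ^+ m).
Proof.
move=> fc; rewrite /right_continuous0; elim: m => [|m IH].
  by rewrite expr0; under eq_fun do rewrite expr0; exact: cvg_cst.
rewrite exprS; under eq_fun do rewrite exprS.
exact: cvgM.
Qed.

Lemma right_continuous0_cst (c : R) : right_continuous0 (fun=> c).
Proof. exact: cvg_cst. Qed.

(** At r = 0 both (1 + r)/2 and (1 - r)/2 equal 1/2, where the logarithm is continuous; the rest is
    polynomial in r. *)
Lemma entropy_sum_cvg n u : right_continuous0 (entropy_sum n u).
Proof.
have mid (f : R -> R) : {for 0, continuous f} -> right_continuous0 f.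
  exact: cvg_at_right_filter.
have ac : right_continuous0 (fun t => (1 + t) / 2).
  by apply: mid; apply: cvgMr_tmp; apply: cvgD; [exact: cvg_cst|exact: cvg_id].
have bc : right_continuous0 (fun t => (1 - t) / 2).
  by apply: mid; apply: cvgMr_tmp; apply: cvgB; [exact: cvg_cst|exact: cvg_id].
have lnc (f : R -> R) :
    right_continuous0 f -> 0 < f 0 -> right_continuous0 (fun t => ln (f t)).
  by move=> fc f0; exact: continuous_cvg (continuous_ln f0) fc.
have a0 : 0 < (1 + 0) / 2 :> R by rewrite addr0 divr_gt0.
have b0 : 0 < (1 - 0) / 2 :> R by rewrite subr0 divr_gt0.
have abc : right_continuous0 (fun t => (1 + t) / 2 * ((1 - t) / 2)) by exact: cvgM.
have entc : right_continuous0 (fun t : R =>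
    n%:R * ((1 + t) / 2 * ln ((1 + t) / 2) + (1 - t) / 2 * ln ((1 - t) / 2))).
  rewrite /right_continuous0; apply: cvgM; first exact: cvg_cst.
  by apply: cvgD; [apply: (cvgM ac)|apply: (cvgM bc)]; exact: lnc.
have sumc d : right_continuous0 (fun t : R =>
    \sum_(i < (n - d - d).+1) ((1 + t) / 2) ^+ (n - d - d - i) * ((1 - t) / 2) ^+ i).
  apply: right_continuous0_sum => i.
  by apply: cvgM; exact: right_continuous0X.
rewrite /right_continuous0 /entropy_sum; apply: (cvgB entc).
apply: (@right_continuous0_sum _ (index_iota 0 n./2.+1) (fun d t =>
  ballot R n d * (((1 + t) / 2 * ((1 - t) / 2)) ^+ d *
    \sum_(i < (n - d - d).+1) ((1 + t) / 2) ^+ (n - d - d - i) * ((1 - t) / 2) ^+ i) *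
  ln (zeta_eigenvalue n u d))) => d.
apply: cvgM; last exact: right_continuous0_cst.
apply: cvgM; first exact: right_continuous0_cst.
by apply: cvgM; [apply: right_continuous0X|exact: sumc].
Qed.

Lemma relative_entropy_sum n u x y z : u < 1 -> x ^+ 2 + y ^+ 2 + z ^+ 2 <= 1 ->
  relative_entropy (ntensmx (bloch_state x y z) n.+1) (zeta n.+1 u) =
  (entropy_sum n.+1 u (Num.sqrt (x ^+ 2 + y ^+ 2 + z ^+ 2)))%:E.
Proof.
move=> u1 ball; set r := Num.sqrt _.
have r0 : 0 <= r by exact: sqrtr_ge0.
have s0 : 0 <= x ^+ 2 + y ^+ 2 + z ^+ 2 by rewrite !addr_ge0 ?sqr_ge0.
have r2 : r ^+ 2 = x ^+ 2 + y ^+ 2 + z ^+ 2 by rewrite sqr_sqrtr.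
have r1 : r <= 1 by rewrite -(@expr_le1 _ 2) // r2.
pose p : measurableTypeR R * measurableTypeR R * measurableTypeR R := (x, y, z).
have [b00 b01 b10 b11] := blochE p.
have bconj (q : measurableTypeR R * measurableTypeR R * measurableTypeR R) i j :
    bloch q i j = (bloch q j i)^*.
  have [q00 q01 q10 q11] := blochE q.
  case: (ord2P i) => ->; case: (ord2P j) => ->; rewrite ?q00 ?q01 ?q10 ?q11;
    apply/eqP; rewrite eq_complex /=; apply/andP; split; apply/eqP; by field.
(* Each tensor power of a state is Hermitian, and the mean commutes with conjugation. *)
have Zherm : zeta n.+1 u \is hermsymmx.
  apply: hermsymmxP => i j; rewrite !zetaE /ball_meanC /=; congr (_ +i* _).
    congr ball_mean; apply/funext => q.
    by rewrite (ntensmx_conj (bconj q)); case: (ntensmx _ _ _ _).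
  rewrite -mulN1r -(ball_meanZ u1); last by have [] := @ntensmx_bounded R n j i.
  congr ball_mean; apply/funext => q.
  by rewrite (ntensmx_conj (bconj q)) mulN1r; case: (ntensmx _ _ _ _).
rewrite (@relative_entropy_ntens _ n (bloch p) _ ((1 + r) / 2) ((1 - r) / 2)
  (zeta_eigenvalue n.+1 u)) //.
- rewrite /mxtrace big_ord_recl big_ord1 (_ : lift _ _ = 1) ?b00 ?b11; last exact: val_inj.
  rewrite -[RHS]rmorphD (_ : (1 + r) / 2 + (1 - r) / 2 = 1); last by field.
  by rewrite [RHS]rmorph1 -mulrDr addrACA subrr addr0 mulVf // pnatr_eq0.
- rewrite det_bloch -rmorphM.
  have -> : (1 + r) / 2 * ((1 - r) / 2) = 4^-1 * one_sub_r2 p :> R.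
    by rewrite (_ : one_sub_r2 p = 1 - r ^+ 2); [field|rewrite r2 /one_sub_r2 /=; ring].
  by rewrite rmorphM fmorphV rmorph_nat.
- by rewrite divr_gt0 // ltr_wpDr.
- by rewrite divr_ge0 // subr_ge0.
- by field.
- by move=> d dn; exact: zeta_eigenvalue_gt0.
- move=> c vc; rewrite (zeta_block u1 vc); case: vc => nE _ _.
  have [dn kE] : (block_deg c + block_deg c <= n.+1)%N /\
      (n.+1 - block_deg c - block_deg c = block_ord c)%N.
    by move: (block_deg c) (block_ord c) nE => d k ->; split; lia.
  by rewrite (zeta_eigenvalueE u dn) kE.
Qed.

End Formula.

Theorem corollary8 (R : realType) (n : nat) (u x y z r : R)
    (n_gt0 : (0 < n)%N) (u_lt1 : u < 1)
    (in_ball : x ^+ 2 + y ^+ 2 + z ^+ 2 <= 1)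
    (rE : r = Num.sqrt (x ^+ 2 + y ^+ 2 + z ^+ 2)) :
  (r != 0 ->
     relative_entropy (ntensmx (bloch_state x y z) n) (zeta n u)
     = (entropy_formula n u r)%:E) /\
  (r = 0 ->
     exists2 s : R,
       entropy_formula n u t @[t --> (0 : R)^'+] --> s &
       relative_entropy (ntensmx (bloch_state x y z) n) (zeta n u) = s%:E).
Proof.
case: n n_gt0 => // n _.
have entE := @relative_entropy_sum R n u x y z u_lt1 in_ball; rewrite -rE in entE.
split=> [r0|r0]; first by rewrite entropy_formulaE.
exists (entropy_sum n.+1 u 0); last by rewrite entE r0.
apply: cvg_trans (@entropy_sum_cvg R n.+1 u).
(* The right-hand filter keeps t nonzero, where the formula and [entropy_sum] coincide. *)
by apply: near_eq_cvg; near=> t; rewrite entropy_formulaE // gt_eqF.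
Unshelve. all: by end_near.
Qed.
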